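(* Let $\Phi(A)$ be an existential second order formula whose only free variable is the second order relation variable $A$, and let $\vec v$ be a tuple of distinct first order variables whose length $|\vec v|$ equals the arity of $A$. Then there exists an independence logic formula $\phi(\vec v)$, with free variables in $\vec v$, such that $$M \models_X \phi(\vec v) \Leftrightarrow M \models \Phi(\mathrm{Rel}_{\vec v}(X))$$ for all models $M$ of the signature of $\Phi$ and all teams $X$ over $M$ whose domain contains $\vec v$.
   Context: All first order models are assumed to have at least two elements in their domain; $\mathrm{Dom}(M)$ is the domain of $M$. An assignment over $M$ is a function from a set of variables to $\mathrm{Dom}(M)$; $s[m/x]$ is the assignment which sends $x$ to $m$ and otherwise agrees with $s$; $t\langle s\rangle$ is the value of the term $t$ in $M$ under $s$, and $\vec t\langle s\rangle$ is the corresponding tuple of values. A team $X$ over $M$ is a set of assignments over $M$ all having the same domain, called the domain of $X$. For a tuple of variables $\vec v = v_1\ldots v_k$ in the domain of $X$, $\mathrm{Rel}_{\vec v}(X) = \{(s(v_1),\ldots,s(v_k)) : s\in X\}$. Independence logic formulas are in negation normal form and are built from first order literals and independence atoms $\vec t_2 ~\bot_{\vec t_1}~ \vec t_3$ (with $\vec t_1,\vec t_2,\vec t_3$ finite, possibly empty, tuples of terms, not necessarily of the same length) using $\wedge,\vee,\exists x,\forall x$. The satisfaction relation $M\models_X\phi$ (lax team semantics), where the domain of $X$ contains the free variables of $\phi$, is: - for a first order literal $\phi$: $M\models_s\phi$ (Tarski) for all $s\in X$; - $M\models_X \vec t_2 ~\bot_{\vec t_1}~ \vec t_3$ iff for all $s,s'\in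 X$ with $\vec t_1\langle s\rangle=\vec t_1\langle s'\rangle$ there is $s''\in X$ with $\vec t_1\langle s''\rangle\vec t_2\langle s''\rangle=\vec t_1\langle s\rangle\vec t_2\langle s\rangle$ and $\vec t_1\langle s''\rangle\vec t_3\langle s''\rangle=\vec t_1\langle s'\rangle\vec t_3\langle s'\rangle$; - $M\models_X\psi\vee\theta$ iff $X=Y\cup Z$ for some teams $Y,Z$ with $M\models_Y\psi$ and $M\models_Z\theta$; - $M\models_X\psi\wedge\theta$ iff $M\models_X\psi$ and $M\models_X\theta$; - $M\models_X\exists x\psi$ iff there is $H:X\to\mathcal P(\mathrm{Dom}(M))\setminus\{\emptyset\}$ with $M\models_{X[H/x]}\psi$, where $X[H/x]=\{s[m/x]:s\in X,\ m\in H(s)\}$; - $M\models_X\forall x\psi$ iff $M\models_{X[M/x]}\psi$, where $X[M/x]=\{s[m/x]:s\in X,\ m\in\mathrm{Dom}(M)\}$.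
   Formalization: The equivalence is stated for nonempty teams X only: on the empty team every independence logic formula holds, while M ⊨ Φ(∅) can fail, for example when Φ(A) is ∃x A(x). *)

(* Defs.v *)
From mathcomp Require Import all_boot.
From mathcomp Require Import boolp classical_sets.

Set Implicit Arguments.
Unset Strict Implicit.
Unset Printing Implicit Defensive.

Local Open Scope classical_set_scope.

Record signature := Signature {
  fsym : Type;
  far : fsym -> nat;
  rsym : Type;
  rar : rsym -> nat }.

Record model (L : signature) := Model {
  dom :> Type;
  fint : forall f : fsym L, ('I_(far f) -> dom) -> dom;
  rint : forall r : rsym L, set ('I_(rar r) -> dom);
  two_elements : exists a b : dom, a <> b }.

Arguments fint {L} M f : rename.
Arguments rint {L} M r : rename.

Definition var := nat.

Inductive term (L : signature) :=
  | Var of var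
  | App (f : fsym L) of 'I_(far f) -> term L.

Arguments App {L} f ts.

Fixpoint term_fv L (t : term L) : set var :=
  match t with
  | Var x => [set x]
  | App f ts => \bigcup_i term_fv (ts i)
  end.

(* An assignment is a partial function: its domain is where it is not [None]. *)
Definition assignment (D : Type) := var -> option D.

Definition asg_dom D (s : assignment D) : set var := [set x | isSome (s x)].

Definition upd D (s : assignment D) (x : var) (m : D) : assignment D :=
  [eta s with x |-> Some m].

(* The tuple of the values of [a] if they are all defined, see [all_defP]. *)
Definition all_def D n (a : 'I_n -> option D) : option ('I_n -> D) :=
  omap (fun b : n.-tuple D => tnth b) (insub (pmap a (enum 'I_n))).

Lemma all_defP D n (a : 'I_n -> option D) (b : 'I_n -> D) :
  all_def a = Some b <-> forall i, a i = Some (b i).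
Proof.
rewrite /all_def; split=> [|ab].
  case: insubP => //= u _ uE [<-] i.
  have sz : size (pmap a (enum 'I_n)) = size (enum 'I_n).
    by rewrite -uE size_tuple size_enum_ord.
  have E : map a (enum 'I_n) = map Some (pmap a (enum 'I_n)).
    move: sz; elim: (enum 'I_n) => //= j l IH.
    case: (a j) => [d /= [/IH ->] //|/= sz].
    suff : size (pmap a l) <= size l by rewrite sz ltnn.
    by rewrite size_pmap count_size.
  have d0 := tnth u i.
  have := congr1 (fun s => nth None s i) E.
  rewrite (nth_map i) ?size_enum_ord // nth_ord_enum => ->.
  rewrite -uE (nth_map d0) ?size_tuple //.
  by congr Some; rewrite -tnth_nth.
have -> : a = Some \o b by apply: funext => i; rewrite /= ab.
have -> : pmap (Some \o b) (enum 'I_n) = map b (enum 'I_n).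
  by elim: (enum 'I_n) => //= j l ->.
case: insubP => [u _ uE|]; last by rewrite size_map size_enum_ord eqxx.
congr Some; apply: funext => i; rewrite (tnth_nth (b i)) uE.
by rewrite (nth_map i) ?size_enum_ord // nth_ord_enum.
Qed.

(* Undefined exactly when some variable of the term is outside the domain. *)
Fixpoint value L (M : model L) (s : assignment M) (t : term L) : option M :=
  match t with
  | Var x => s x
  | App f ts => omap (fint M f) (all_def (fun i => value s (ts i)))
  end.

Inductive atom (L : signature) :=
  | Eq of term L & term L
  | Rel (r : rsym L) of 'I_(rar r) -> term L.

Arguments Rel {L} r ts.

Definition atom_fv L (a : atom L) : set var :=
  match a with
  | Eq t1 t2 => term_fv t1 `|` term_fv t2
  | Rel r ts => \bigcup_i term_fv (ts i)
  end.

Definition atom_sat L (M : model L) (s : assignment M) (a : atom L) : Prop :=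
  match a with
  | Eq t1 t2 => value s t1 = value s t2
  | Rel r ts =>
      if all_def (fun i => value s (ts i)) is Some b then rint M r b else False
  end.

Inductive fo (L : signature) :=
  | FAtom of atom L
  | FNot of fo L
  | FAnd of fo L & fo L
  | FOr of fo L & fo L
  | FEx of var & fo L
  | FAll of var & fo L.

Fixpoint fo_fv L (psi : fo L) : set var :=
  match psi with
  | FAtom a => atom_fv a
  | FNot p => fo_fv p
  | FAnd p q | FOr p q => fo_fv p `|` fo_fv q
  | FEx x p | FAll x p => fo_fv p `\ x
  end.

Fixpoint fo_sat L (M : model L) (s : assignment M) (psi : fo L) : Prop :=
  match psi with
  | FAtom a => atom_sat s a
  | FNot p => ~ fo_sat s p
  | FAnd p q => fo_sat s p /\ fo_sat s q
  | FOr p q => fo_sat s p \/ fo_sat s q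
  | FEx x p => exists m : M, fo_sat (upd s x m) p
  | FAll x p => forall m : M, fo_sat (upd s x m) p
  end.

(* A second order variable is a fresh symbol of an expanded signature, namely
   [None]; assigning it a value expands the model. Thus a formula of
   [eso (add_rel L k)] is a formula over [L] whose only possible free second
   order variable is a [k]-ary relation variable. *)

Definition add_rel (L : signature) (k : nat) : signature :=
  {| fsym := fsym L;
     far := @far L;
     rsym := option (rsym L);
     rar := oapp (@rar L) k |}.

Definition add_fun (L : signature) (k : nat) : signature :=
  {| fsym := option (fsym L);
     far := oapp (@far L) k;
     rsym := rsym L;
     rar := @rar L |}.

Definition expand_rel L (M : model L) k (A : set ('I_k -> M)) :
    model (add_rel L k) :=
  @Model (add_rel L k) M (fint M)
    (fun r : option (rsym L) =>
       match r return set ('I_(oapp (@rar L) k r) -> M) with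
       | Some r' => rint M r'
       | None => A
       end)
    (two_elements M).

Definition expand_fun L (M : model L) k (g : ('I_k -> M) -> M) :
    model (add_fun L k) :=
  @Model (add_fun L k) M
    (fun f : option (fsym L) =>
       match f return ('I_(oapp (@far L) k f) -> M) -> M with
       | Some f' => fint M f'
       | None => g
       end)
    (rint M) (two_elements M).

Inductive eso (L : signature) :=
  | Matrix of fo L
  | ExRel k of eso (add_rel L k)
  | ExFun k of eso (add_fun L k).

(* Free first order variables. *)
Fixpoint eso_fv L (Phi : eso L) : set var :=
  match Phi with
  | Matrix psi => fo_fv psi
  | ExRel _ Psi => eso_fv Psi
  | ExFun _ Psi => eso_fv Psi
  end.

Fixpoint eso_sat L (Phi : eso L) : forall M : model L, assignment M -> Prop :=
  match Phi with
  | Matrix psi => fun M s => fo_sat s psi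
  | ExRel k Psi => fun M s =>
      exists A : set ('I_k -> M), @eso_sat _ Psi (expand_rel A) s
  | ExFun k Psi => fun M s =>
      exists g : ('I_k -> M) -> M, @eso_sat _ Psi (expand_fun g) s
  end.

(* Truth of a formula without free first order variables. *)
Definition eso_true L (M : model L) (Phi : eso L) : Prop :=
  @eso_sat L Phi M (fun=> None).

(* [Indep t2 t1 t3] is the atom t2 _||_{t1} t3. *)
Inductive ind (L : signature) :=
  | Pos of atom L
  | Neg of atom L
  | Indep of seq (term L) & seq (term L) & seq (term L)
  | And of ind L & ind L
  | Or of ind L & ind L
  | Ex of var & ind L
  | All of var & ind L.

Definition terms_fv L (ts : seq (term L)) : set var :=
  \big[setU/set0]_(t <- ts) term_fv t.

Fixpoint ind_fv L (phi : ind L) : set var :=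
  match phi with
  | Pos a | Neg a => atom_fv a
  | Indep t2 t1 t3 => terms_fv t1 `|` terms_fv t2 `|` terms_fv t3
  | And p q | Or p q => ind_fv p `|` ind_fv q
  | Ex x p | All x p => ind_fv p `\ x
  end.

Definition values L (M : model L) (s : assignment M) (ts : seq (term L)) :
    seq (option M) :=
  [seq value s t | t <- ts].

Definition team_domain D (X : set (assignment D)) (V : set var) : Prop :=
  forall s, X s -> asg_dom s = V.

Definition supplement D (X : set (assignment D)) (H : assignment D -> set D)
    (x : var) : set (assignment D) :=
  [set s' | exists s m, [/\ X s, H s m & s' = upd s x m]].

Definition duplicate D (X : set (assignment D)) (x : var) :
    set (assignment D) :=
  [set s' | exists s m, X s /\ s' = upd s x m].

Fixpoint ind_sat L (M : model L) (X : set (assignment M)) (phi : ind L) :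
    Prop :=
  match phi with
  | Pos a => forall s, X s -> atom_sat s a
  | Neg a => forall s, X s -> ~ atom_sat s a
  | Indep t2 t1 t3 =>
      forall s s', X s -> X s' -> values s t1 = values s' t1 ->
      exists s'', [/\ X s'',
        values s'' (t1 ++ t2) = values s (t1 ++ t2) &
        values s'' (t1 ++ t3) = values s' (t1 ++ t3)]
  | And p q => ind_sat X p /\ ind_sat X q
  | Or p q => exists Y Z, [/\ X = Y `|` Z, ind_sat Y p & ind_sat Z q]
  | Ex x p => exists H : assignment M -> set M,
      (forall s, X s -> H s !=set0) /\ ind_sat (supplement X H x) p
  | All x p => ind_sat (duplicate X x) p
  end.

(* The relation Rel_v(X) of a team whose domain contains [v]. *)
Definition team_rel D k (v : k.-tuple var) (X : set (assignment D)) :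
    set ('I_k -> D) :=
  [set a | exists2 s, X s & forall i, s (tnth v i) = Some (a i)].

(* Main.v *)
Require Import Defs.
From mathcomp Require Import all_boot.
From mathcomp Require Import boolp classical_sets.
From mathcomp Require Import zify.

Set Implicit Arguments.
Unset Strict Implicit.
Unset Printing Implicit Defensive.

Local Open Scope classical_set_scope.

(* Relations are encoded by functions, and Skolemization together with the
   replacement of every function application [f ts] by a fresh variable [y] and
   fresh universal variables [ws], guarded by [ws = ts], brings the formula to
   the form: there are functions such that, for all values of the [ws], if every
   [y] is the value of its function at its [ws], then [theta] holds, where
   [theta] is quantifier free and does not mention A. Over a team this is said
   by quantifying the [ws] universally and the [ys] existentially: conditional
   independence makes each [y] a function of its [ws], equal arguments of one
   function get equal values, and first order literals are evaluated row by row.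
   As the [ws] range over all values in combination with each row of the original
   team, "the relation coded by the function of A contains Rel(X)" is a first
   order condition on rows, and the converse inclusion is an inclusion atom,
   which an independence atom expresses. *)

(** * Argument tuples as lists, and the values of terms *)

Definition args T n (a : 'I_n -> T) : seq T := [seq a i | i <- enum 'I_n].

Lemma size_args T n (a : 'I_n -> T) : size (args a) = n.
Proof. by rewrite size_map size_enum_ord. Qed.

Lemma nth_args T x0 n (a : 'I_n -> T) (i : 'I_n) : nth x0 (args a) i = a i.
Proof. by rewrite (nth_map i) ?size_enum_ord // nth_ord_enum. Qed.

Lemma map_args T T' (g : T -> T') n (a : 'I_n -> T) :
  map g (args a) = args (g \o a).
Proof. by rewrite /args -map_comp. Qed.

Lemma args_nth T x0 n (l : seq T) :
  size l = n -> args (fun i : 'I_n => nth x0 l i) = l.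
Proof.
move=> sl; apply: (@eq_from_nth _ x0); rewrite size_args ?sl // => i lt_in.
by rewrite (nth_args x0 (fun i : 'I_n => nth x0 l i) (Ordinal lt_in)).
Qed.

Lemma nth_cat_args T x0 (e : seq T) n (a : 'I_n -> T) :
  (fun i : 'I_n => nth x0 (e ++ args a) (size e + i)) = a.
Proof.
by apply/funext => i; rewrite nth_cat ltnNge leq_addr addKn nth_args.
Qed.

Lemma value_eq L (M : model L) (s s' : assignment M) (t : term L) :
  (forall x, term_fv t x -> s x = s' x) -> value s t = value s' t.
Proof.
elim: t => [x|f ts IH] ss' /=; first exact: ss'.
congr (omap _ (all_def _)); apply/funext => i.
by apply: IH => x tx; apply: ss'; exists i.
Qed.

Lemma value_defined L (M : model L) (s : assignment M) (t : term L) :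
  (forall x, term_fv t x -> exists m, s x = Some m) ->
  exists m, value s t = Some m.
Proof.
elim: t => [x|f ts IH] sd /=; first exact: sd.
have /choice[b bE] i : exists m, value s (ts i) = Some m.
  by apply: IH => x tx; apply: sd; exists i.
by exists (fint M f b); move/all_defP: bE => ->.
Qed.

Lemma atom_sat_eq L (M : model L) (s s' : assignment M) (a : atom L) :
  (forall x, atom_fv a x -> s x = s' x) -> atom_sat s a = atom_sat s' a.
Proof.
case: a => [t u|r ts] ss' /=.
  by rewrite (@value_eq _ _ s s' t) 1?(@value_eq _ _ s s' u) // => x tx;
    apply: ss'; [right | left].
suff -> : (fun i => value s (ts i)) = (fun i => value s' (ts i)) by [].
by apply/funext => i; apply: value_eq => x tx; apply: ss'; exists i.
Qed.

(** * Quantification over functions of arbitrarily many arguments *)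

(* Variables are de Bruijn levels: [SEx] binds the variable numbered by the
   length of the environment. *)
Inductive sf (L : signature) :=
  | SLit of atom L
  | SFun of nat & seq var & var
  | SNot of sf L
  | SAnd of sf L & sf L
  | SEx of sf L.

Arguments SFun {L} j zs y.

(** Functions act on lists of any length, so a single sequence [E] holds functions of all arities. A
    level outside [e] denotes the default [m0]. *)
Fixpoint sf_sat L (M : model L) (E : nat -> seq M -> M) (m0 : M) (e : seq M)
    (p : sf L) : Prop :=
  match p with
  | SLit a => atom_sat (fun x => Some (nth m0 e x)) a
  | SFun j zs y => E j [seq nth m0 e z | z <- zs] = nth m0 e y
  | SNot q => ~ sf_sat E m0 e q
  | SAnd q r => sf_sat E m0 e q /\ sf_sat E m0 e r
  | SEx q => exists m, sf_sat E m0 (rcons e m) q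
  end.

Definition SAll L (p : sf L) := SNot (SEx (SNot p)).

Lemma sf_sat_all L (M : model L) E (m0 : M) e (p : sf L) :
  sf_sat E m0 e (SAll p) <-> forall m, sf_sat E m0 (rcons e m) p.
Proof.
split=> /= [nex m|all [m]]; last by apply.
by apply: contrapT => np; apply: nex; exists m.
Qed.

Lemma sf_sat_exs L (M : model L) E (m0 : M) n e (p : sf L) :
  sf_sat E m0 e (iter n (@SEx L) p) <->
  exists a : 'I_n -> M, sf_sat E m0 (e ++ args a) p.
Proof.
(* Tuples of length [n] are traded for lists of size [n], from which the induction peels off one
   element at a time. *)
have -> : (exists a : 'I_n -> M, sf_sat E m0 (e ++ args a) p) =
          (exists2 l, size l = n & sf_sat E m0 (e ++ l) p).
  apply/propext; split=> [[a pa]|[l ln pl]].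
    by exists (args a); rewrite ?size_args.
  by exists (fun i => nth m0 l i); rewrite args_nth.
elim: n e => [|n IH] e /=.
  split=> [pe|[[|m l]//= _]]; last by rewrite cats0.
  by exists [::]; rewrite ?cats0.
split=> [[m /IH [l ln]]|[[|m l]//= [ln]]].
  by rewrite cat_rcons; exists (m :: l); rewrite /= ?ln.
by rewrite -cat_rcons => pl; exists m; apply/IH; exists l.
Qed.

Lemma sf_sat_ands L (M : model L) E (m0 : M) n e (F : 'I_n -> sf L) p :
  sf_sat E m0 e (foldr (@SAnd L) p (args F)) <->
  (forall i, sf_sat E m0 e (F i)) /\ sf_sat E m0 e p.
Proof.
have -> : (forall i, sf_sat E m0 e (F i)) =
          (forall i, i \in enum 'I_n -> sf_sat E m0 e (F i)).
  by apply/propext; split=> Fe i; [move=> _|]; apply: Fe; rewrite ?mem_enum.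
rewrite /args; elim: (enum 'I_n) => [|i l IH] /=; first by split=> // -[].
rewrite IH; split=> [[Fi [Fl pe]]|[Fl pe]].
  by split=> // j; rewrite inE => /predU1P[->|/Fl].
split; first by apply: Fl; rewrite mem_head.
by split=> // j jl; apply: Fl; rewrite inE jl orbT.
Qed.

(* How symbols of [S] are expressed over [L] and the quantified functions; the
   second argument of [irel] is the first level that is not in use. *)
Record interp (L S : signature) := Interp {
  ifun : forall f : Defs.fsym S, ('I_(far f) -> var) -> var -> sf L;
  irel : forall r : rsym S, nat -> ('I_(rar r) -> var) -> sf L }.

(** Terms are translated as graphs: the result says that level [y] holds the value of [t]. Nested
    applications are thereby flattened, each argument being given its own level, from [d] on. *)
Fixpoint sf_of_term L S (I : interp L S) (tau : var -> var) (d : nat)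
    (t : term S) (y : var) : sf L :=
  match t with
  | Var x => SLit (Eq (Var L (tau x)) (Var L y))
  | App f ts =>
      iter (far f) (@SEx L)
        (foldr (@SAnd L) (ifun I (fun i : 'I_(far f) => d + i) y)
           (args (fun i => sf_of_term I tau (d + far f) (ts i) (d + i))))
  end.

Fixpoint sf_of_fo L S (I : interp L S) (tau : var -> var) (d : nat)
    (psi : fo S) : sf L :=
  match psi with
  | FAtom (Eq t u) =>
      SEx (SAnd (sf_of_term I tau d.+1 t d) (sf_of_term I tau d.+1 u d))
  | FAtom (Rel r ts) =>
      iter (rar r) (@SEx L)
        (foldr (@SAnd L) (irel I (d + rar r) (fun i : 'I_(rar r) => d + i))
           (args (fun i => sf_of_term I tau (d + rar r) (ts i) (d + i))))
  | FNot p => SNot (sf_of_fo I tau d p)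
  | FAnd p q => SAnd (sf_of_fo I tau d p) (sf_of_fo I tau d q)
  | FOr p q =>
      SNot (SAnd (SNot (sf_of_fo I tau d p)) (SNot (sf_of_fo I tau d q)))
  | FEx x p => SEx (sf_of_fo I [eta tau with x |-> d] d.+1 p)
  | FAll x p => SAll (sf_of_fo I [eta tau with x |-> d] d.+1 p)
  end.

Definition agree T (n : nat) (E E' : nat -> T) := forall j, j < n -> E' j = E j.

(* Quantifying over [E'] says that only the functions below [j] are used. *)
Definition interp_ok L S (I : interp L S) (M : model L)
    (fS : forall f : Defs.fsym S, ('I_(far f) -> M) -> M)
    (rS : forall r : rsym S, set ('I_(rar r) -> M))
    (j : nat) (E : nat -> seq M -> M) : Prop :=
  forall E', agree j E E' ->
  (forall f m0 e (z : 'I_(far f) -> var) y,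
     sf_sat E' m0 e (ifun I z y) <->
     fS f (fun i => nth m0 e (z i)) = nth m0 e y) /\
  (forall r m0 e (z : 'I_(rar r) -> var), (forall i, z i < size e) ->
     sf_sat E' m0 e (irel I (size e) z) <-> rS r (fun i => nth m0 e (z i))).

(** The bound on [tau x] keeps values fixed when [e] grows: a level out of range could change from
    the default to a new element. *)
Definition covers D (m0 : D) (e : seq D) (tau : var -> var) (s : assignment D)
    (V : set var) :=
  forall x, V x -> s x = Some (nth m0 e (tau x)) /\ tau x < size e.

Lemma covers_cat D (m0 : D) e l tau s V :
  covers m0 e tau s V -> covers m0 (e ++ l) tau s V.
Proof.
move=> cov x /cov[sx ltx]; rewrite nth_cat ltx size_cat; split=> //.
exact: leq_trans ltx (leq_addr _ _).
Qed.

Lemma covers_rcons D (m0 : D) e m tau s V :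
  covers m0 e tau s V -> covers m0 (rcons e m) tau s V.
Proof. by rewrite -cats1; apply: covers_cat. Qed.

Lemma covers_upd D (m0 : D) e m tau s x V :
  covers m0 e tau s (V `\ x) ->
  covers m0 (rcons e m) [eta tau with x |-> size e] (upd s x m) V.
Proof.
move=> cov y Vy; rewrite /upd /= size_rcons nth_rcons.
case: eqVneq => [_|/eqP yx]; first by rewrite ltnn eqxx ltnSn.
by have [-> lty] := cov y (conj Vy yx); rewrite lty ltnW.
Qed.

Lemma covers_sub D (m0 : D) e tau s (V W : set var) :
  V `<=` W -> covers m0 e tau s W -> covers m0 e tau s V.
Proof. by move=> VW cov x /VW/cov. Qed.

(** By induction the levels bound for the arguments can hold nothing but the values of the
    arguments, so the existence of such levels amounts to the argument tuple being defined, together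
    with the condition on [f]. *)
Lemma sf_of_termP L S (I : interp L S) (M : model L) fS rS j E
    (ok : @interp_ok L S I M fS rS j E) (m0 : M) tau (s : assignment M)
    (t : term S) e y :
  covers m0 e tau s (term_fv t) -> y < size e ->
  sf_sat E m0 e (sf_of_term I tau (size e) t y) <->
  @value S (Model fS rS (two_elements M)) s t = Some (nth m0 e y).
Proof.
have [okf okr] := ok E (fun _ _ => erefl).
elim: t e y => [x|f ts IH] e y cov ye /=.
  by have [-> _] := cov x erefl.
rewrite sf_sat_exs.
have IHi (a : 'I_(far f) -> M) i :
    sf_sat E m0 (e ++ args a)
      (sf_of_term I tau (size e + far f) (ts i) (size e + i)) <->
    @value S (Model fS rS (two_elements M)) s (ts i) = Some (a i).
  have -> : size e + far f = size (e ++ args a) by rewrite size_cat size_args.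
  rewrite IH ?size_cat ?size_args ?ltn_add2l ?ltn_ord //.
    by rewrite nth_cat ltnNge leq_addr addKn /= nth_args.
  by apply/covers_cat/(covers_sub _ cov) => x tx; exists i.
have fE (a : 'I_(far f) -> M) :
    sf_sat E m0 (e ++ args a) (ifun I (fun i : 'I_(far f) => size e + i) y) <->
    fS f a = nth m0 e y.
  by rewrite okf nth_cat_args nth_cat ye.
split=> [[a /sf_sat_ands[ta /fE fa]]|].
  rewrite (_ : all_def _ = Some a) /= ?fa //.
  by apply/all_defP => i; apply/IHi/ta.
case aE: (all_def _) => [a|//] [fa].
move/all_defP: aE => aE; exists a; apply/sf_sat_ands.
by split=> [i|]; [exact/IHi|exact/fE].
Qed.

Lemma sf_of_foP L S (I : interp L S) (M : model L) fS rS j E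
    (ok : @interp_ok L S I M fS rS j E) (m0 : M) (psi : fo S) tau
    (s : assignment M) e :
  covers m0 e tau s (fo_fv psi) ->
  sf_sat E m0 e (sf_of_fo I tau (size e) psi) <->
  @fo_sat S (Model fS rS (two_elements M)) s psi.
Proof.
have [okf okr] := ok E (fun _ _ => erefl).
elim: psi tau s e => [[t u|r ts]|p IH|p IHp q IHq|p IHp q IHq|x p IH|x p IH]
  tau s e cov.
- have tE m : sf_sat E m0 (rcons e m) (sf_of_term I tau (size e).+1 t (size e))
      <-> @value S (Model fS rS (two_elements M)) s t = Some m.
    rewrite -(size_rcons e m) (sf_of_termP ok (s := s)) ?size_rcons //.
      by rewrite nth_rcons ltnn eqxx.
    by apply/covers_rcons/(covers_sub _ cov) => x tx; left.
  have uE m : sf_sat E m0 (rcons e m) (sf_of_term I tau (size e).+1 u (size e))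
      <-> @value S (Model fS rS (two_elements M)) s u = Some m.
    rewrite -(size_rcons e m) (sf_of_termP ok (s := s)) ?size_rcons //.
      by rewrite nth_rcons ltnn eqxx.
    by apply/covers_rcons/(covers_sub _ cov) => x tx; right.
  split=> [[m [/tE tm /uE um]]|/= tu]; first by rewrite /= tm um.
  (* Equality of terms compares options and would also hold between two undefined values; covering
     the free variables yields an actual common value. *)
  have [|m tm] := @value_defined S (Model fS rS (two_elements M)) s t.
    by move=> x tx; have [|-> _] := cov x; [left|exists (nth m0 e (tau x))].
  by exists m; split; [apply/tE|apply/uE; rewrite -tu].
- rewrite [sf_of_fo _ _ _ _]/= sf_sat_exs.
  have tE (a : 'I_(rar r) -> M) i :
      sf_sat E m0 (e ++ args a)
        (sf_of_term I tau (size e + rar r) (ts i) (size e + i)) <->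
      @value S (Model fS rS (two_elements M)) s (ts i) = Some (a i).
    have -> : size e + rar r = size (e ++ args a) by rewrite size_cat size_args.
    rewrite (sf_of_termP ok (s := s)) ?size_cat ?size_args //;
      last by rewrite ltn_add2l.
      by rewrite nth_cat ltnNge leq_addr addKn /= nth_args.
    by apply/covers_cat/(covers_sub _ cov) => x tx; exists i.
  have rE (a : 'I_(rar r) -> M) :
      sf_sat E m0 (e ++ args a)
        (irel I (size e + rar r) (fun i : 'I_(rar r) => size e + i)) <-> rS r a.
    have -> : size e + rar r = size (e ++ args a) by rewrite size_cat size_args.
    rewrite okr => [|i]; last by rewrite size_cat size_args ltn_add2l.
    by rewrite nth_cat_args.
  split=> [[a /sf_sat_ands[ta /rE ra]]|/=].
    rewrite /= (_ : all_def _ = Some a) //.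
    by apply/all_defP => i; apply/tE/ta.
  case aE: (all_def _) => [a|//] ra.
  move/all_defP: aE => aE; exists a.
  by apply/sf_sat_ands; split=> [i|]; [apply/tE|apply/rE].
- by rewrite /= (IH _ s).
- have {}IHp := IHp tau s e (covers_sub (@subsetUl _ _ _) cov).
  have {}IHq := IHq tau s e (covers_sub (@subsetUr _ _ _) cov).
  by rewrite /= IHp IHq.
- have {}IHp := IHp tau s e (covers_sub (@subsetUl _ _ _) cov).
  have {}IHq := IHq tau s e (covers_sub (@subsetUr _ _ _) cov).
  rewrite /= IHp IHq -not_orP; split=> [/contrapT//|pq]; exact.
- have {}IH m := IH _ _ _ (covers_upd m cov).
  split=> -[m pm]; exists m; move: pm (IH m); rewrite size_rcons => pm h; exact/h.
- have {}IH m := IH _ _ _ (covers_upd m cov).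
  rewrite [sf_of_fo _ _ _ _]/= sf_sat_all.
  by split=> all m; move: (all m) (IH m); rewrite size_rcons => pm h; apply/h.
Qed.

Lemma agree_trans T n n' (E E' E'' : nat -> T) :
  n <= n' -> agree n E E' -> agree n' E' E'' -> agree n E E''.
Proof. by move=> nn' a b j jn; rewrite b ?(leq_trans jn) // a. Qed.

Lemma agree_set T n (E : nat -> T) g : agree n E [eta E with n |-> g].
Proof. by move=> j /= jn; rewrite ltn_eqF. Qed.

(* A relation R is coded by a function g such that R(a) iff g(b, a) = b for all
   b; the extra argument is there to have something to compare with. *)
Definition sf_rel L (j d : nat) (zs : seq var) : sf L :=
  SAll (SFun j (d :: zs) d).

Lemma sf_relP L (M : model L) E (m0 : M) e j n (z : 'I_n -> var) :
  (forall i, z i < size e) ->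
  sf_sat E m0 e (sf_rel L j (size e) (args z)) <->
  forall b, E j (b :: args (fun i => nth m0 e (z i))) = b.
Proof.
move=> ze; rewrite sf_sat_all.
have zE b : [seq nth m0 (rcons e b) i | i <- args z] =
    args (fun i => nth m0 e (z i)).
  by rewrite map_args; congr args; apply/funext => i /=; rewrite nth_rcons ze.
by split=> Eb b; move: (Eb b); rewrite /= zE nth_rcons ltnn eqxx.
Qed.

(** Off [A] the function returns an element different from its first argument, which exists in a
    model with two elements. Thus a single [b] already decides membership, although [sf_rel] asks
    for all. *)
Lemma rel_as_fun L (M : model L) n (A : set ('I_n -> M)) :
  exists g : seq M -> M, forall b a, g (b :: args a) = b <-> A a.
Proof.
have /choice[other otherP] (b : M) : exists b', b' <> b.
  have [c [d cd]] := two_elements M.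
  have [cb|] := pselect (c = b); last by exists c.
  by exists d; rewrite -cb; exact/nesym.
exists (fun l => if l is b :: l' then
  if pselect (A (fun i => nth b l' i)) then b else other b
  else sval (cid (two_elements M))).
move=> b a /=; rewrite (_ : (fun i => _) = a); last first.
  by apply/funext => i; rewrite nth_args.
by case: pselect => Aa; split=> //; first move=> /otherP.
Qed.

(** * Interpretations, and the translation of second order quantifiers *)

Definition interp_id L k : interp L (add_rel L k) :=
  @Interp L (add_rel L k)
    (fun (f : Defs.fsym L) z y =>
       SLit (Eq (App f (fun i => Var L (z i))) (Var L y)))
    (fun r : option (rsym L) =>
       match r return nat -> ('I_(oapp (@rar L) k r) -> var) -> sf L with
       | Some r' => fun _ z => SLit (Rel r' (fun i => Var L (z i)))
       | None => fun d z => sf_rel L 0 d (args z)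
       end).

Definition interp_rel L S (I : interp L S) (k j : nat) :
    interp L (add_rel S k) :=
  @Interp L (add_rel S k) (@ifun L S I)
    (fun r : option (rsym S) =>
       match r return nat -> ('I_(oapp (@rar S) k r) -> var) -> sf L with
       | Some r' => @irel L S I r'
       | None => fun d z => sf_rel L j d (args z)
       end).

Definition interp_fun L S (I : interp L S) (k j : nat) :
    interp L (add_fun S k) :=
  @Interp L (add_fun S k)
    (fun f : option (Defs.fsym S) =>
       match f return ('I_(oapp (@far S) k f) -> var) -> var -> sf L with
       | Some f' => @ifun L S I f'
       | None => fun z y => SFun j (args z) y
       end)
    (@irel L S I).

(** [j] is the first function index not in use, and each second order quantifier claims it; in
    [interp_id] index [0] belongs to A. *)
Fixpoint sf_of_eso L S (Phi : eso S) : interp L S -> nat -> sf L :=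
  match Phi with
  | Matrix psi => fun I _ => sf_of_fo I id 0 psi
  | ExRel k Psi => fun I j => sf_of_eso Psi (interp_rel I k j) j.+1
  | ExFun k Psi => fun I j => sf_of_eso Psi (interp_fun I k j) j.+1
  end.

Lemma interp_id_ok L (M : model L) k (A : set ('I_k -> M)) E :
  (forall a, A a <-> forall b, E 0 (b :: args a) = b) ->
  let MA := expand_rel A in
  @interp_ok L _ (interp_id L k) M (fint MA) (rint MA) 1 E.
Proof.
move=> AE MA E' E'E; split=> [f m0 e z y|[r|] m0 e z ze].
- rewrite [ifun _ _ _]/= [sf_sat _ _ _ _]/=.
  rewrite (_ : all_def _ = Some (fun i => nth m0 e (z i))); last exact/all_defP.
  by split=> /= [[]|->].
- rewrite /= (_ : all_def _ = Some (fun i => nth m0 e (z i))) //.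
  exact/all_defP.
- by rewrite sf_relP // E'E //= AE.
Qed.

Lemma interp_rel_ok L S (I : interp L S) (M : model L) fS rS k j E
    (A : set ('I_k -> M)) :
  @interp_ok L S I M fS rS j E ->
  (forall a, A a <-> forall b, E j (b :: args a) = b) ->
  let MA := @expand_rel S (Model fS rS (two_elements M)) k A in
  @interp_ok L _ (interp_rel I k j) M (fint MA) (rint MA) j.+1 E.
Proof.
move=> ok AE MA E' E'E.
have [|okf okr] := ok E'; first by move=> i ij; apply: E'E; apply: ltnW.
split=> [//|[r|] m0 e z ze]; first exact: okr.
by rewrite sf_relP // E'E //= AE.
Qed.

Lemma interp_fun_ok L S (I : interp L S) (M : model L) fS rS k j E
    (g : ('I_k -> M) -> M) :
  @interp_ok L S I M fS rS j E ->
  (forall a, E j (args a) = g a) ->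
  let Mg := @expand_fun S (Model fS rS (two_elements M)) k g in
  @interp_ok L _ (interp_fun I k j) M (fint Mg) (rint Mg) j.+1 E.
Proof.
move=> ok gE Mg E' E'E.
have [|okf okr] := ok E'; first by move=> i ij; apply: E'E; apply: ltnW.
split=> [[f|] m0 e z y|//]; first exact: okf.
by rewrite /= map_args E'E //= gE.
Qed.

Lemma interp_ok_agree L S (I : interp L S) (M : model L) fS rS j E E' :
  @interp_ok L S I M fS rS j E -> agree j E E' -> @interp_ok L S I M fS rS j E'.
Proof. by move=> ok EE' E'' E'E; apply: ok; apply: agree_trans EE' E'E. Qed.

(** Witnesses are stored at successive indices. Overwriting index [j] is harmless, since the
    interpretation built so far reads only functions below [j]. *)
Lemma sf_of_eso_complete L S (Phi : eso S) (I : interp L S) (M : model L) fS rS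
    j E :
  @interp_ok L S I M fS rS j E -> eso_fv Phi = set0 ->
  @eso_sat S Phi (Model fS rS (two_elements M)) (fun=> None) ->
  exists E', agree j E E' /\ forall m0, sf_sat E' m0 [::] (sf_of_eso Phi I j).
Proof.
elim: Phi I fS rS j E => [S0 psi|S0 k Psi IH|S0 k Psi IH] I fS rS j E ok cl.
- move=> psiS; exists E; split=> // m0.
  apply/(sf_of_foP (e := [::]) ok); last exact: psiS.
  by rewrite [fo_fv _]cl.
- move=> [A PsiA]; have [g gA] := @rel_as_fun _ M k A.
  have AE a : A a <-> forall b, [eta E with j |-> g] j (b :: args a) = b.
    by rewrite /= eqxx; split=> [Aa b|gb]; [apply/gA|apply/(gA (g [::]))].
  have ok' := interp_rel_ok (interp_ok_agree ok (@agree_set _ j E g)) AE.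
  have [E' [EE' E'Psi]] := IH _ _ _ _ _ ok' cl PsiA.
  exists E'; split=> //; apply: agree_trans EE' => //; exact: agree_set.
- move=> [g PsiG]; have [m _] := two_elements M.
  (* [g] is transferred to lists; the default [m] never shows on lists of length [k]. *)
  pose h l := g (fun i => nth m l i).
  have hE a : [eta E with j |-> h] j (args a) = g a.
    by rewrite /= eqxx /h; congr g; apply/funext => i; rewrite nth_args.
  have ok' := interp_fun_ok (interp_ok_agree ok (@agree_set _ j E h)) hE.
  have [E' [EE' E'Psi]] := IH _ _ _ _ _ ok' cl PsiG.
  exists E'; split=> //; apply: agree_trans EE' => //; exact: agree_set.
Qed.

(** Every function codes some relation, namely the set of [a] with [E j (b :: args a) = b] for all
    [b], so witnesses can be read off an arbitrary [E]. *)
Lemma sf_of_eso_sound L S (Phi : eso S) (I : interp L S) (M : model L) fS rS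
    j E m0 :
  @interp_ok L S I M fS rS j E -> eso_fv Phi = set0 ->
  sf_sat E m0 [::] (sf_of_eso Phi I j) ->
  @eso_sat S Phi (Model fS rS (two_elements M)) (fun=> None).
Proof.
elim: Phi I fS rS j => [S0 psi|S0 k Psi IH|S0 k Psi IH] I fS rS j ok cl.
- move=> psiS; apply/(sf_of_foP (e := [::]) ok); last exact: psiS.
  by rewrite [fo_fv _]cl.
- move=> PsiE; exists (fun a => forall b, E j (b :: args a) = b).
  by apply: IH PsiE => //; apply: interp_rel_ok.
- move=> PsiE; exists (fun a => E j (args a)).
  by apply: IH PsiE => //; apply: interp_fun_ok.
Qed.

(** * Skolemization *)

Fixpoint flat L (phi : ind L) : bool :=
  match phi with
  | Pos _ | Neg _ => true
  | And p q | Or p q => flat p && flat q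
  | _ => false
  end.

Fixpoint flat_sat L (M : model L) (s : assignment M) (phi : ind L) : Prop :=
  match phi with
  | Pos a => atom_sat s a
  | Neg a => ~ atom_sat s a
  | And p q => flat_sat s p /\ flat_sat s q
  | Or p q => flat_sat s p \/ flat_sat s q
  | _ => False
  end.

(** For a disjunction the team is split into the rows satisfying the one disjunct and the rows
    satisfying the other; the two parts may overlap. *)
Lemma flatP L (M : model L) (X : set (assignment M)) (phi : ind L) :
  flat phi -> ind_sat X phi <-> forall s, X s -> flat_sat s phi.
Proof.
elim: phi X => //= [p IHp q IHq|p IHp q IHq] X /andP[/IHp{}IHp /IHq{}IHq].
  rewrite IHp IHq; split=> [[Xp Xq] s Xs|pq].
    by split; [exact: Xp|exact: Xq].
  by split=> s /pq[].
split=> [[Y [Z [-> /IHp Yp /IHq Zq]]] s [/Yp|/Zq]|pq]; [by left|by right|].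
exists [set s | X s /\ flat_sat s p], [set s | X s /\ flat_sat s q].
split; [|by apply/IHp => s []|by apply/IHq => s []].
apply/seteqP; split=> [s Xs|s [[]//|[]//]].
by case: (pq s Xs); [left|right].
Qed.

Lemma flat_sat_eq L (M : model L) (s s' : assignment M) (phi : ind L) :
  (forall x, ind_fv phi x -> s x = s' x) -> flat_sat s phi = flat_sat s' phi.
Proof.
elim: phi => //= [a|a|p IHp q IHq|p IHp q IHq] ss'.
- exact: atom_sat_eq.
- by rewrite (atom_sat_eq ss').
- by rewrite IHp ?IHq // => x; [move=> qx|move=> px]; apply: ss'; [right|left].
- by rewrite IHp ?IHq // => x; [move=> qx|move=> px]; apply: ss'; [right|left].
Qed.

Definition eqv L (x y : var) : ind L := Pos (Eq (Var L x) (Var L y)).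
Definition neqv L (x y : var) : ind L := Neg (Eq (Var L x) (Var L y)).

(** The implication from [xs = ys] to [phi], in negation normal form. *)
Fixpoint guard L (xs ys : seq var) (phi : ind L) : ind L :=
  match xs, ys with
  | x :: xs', y :: ys' => Or (neqv L x y) (guard xs' ys' phi)
  | _, _ => phi
  end.

Lemma flat_guard L xs ys (phi : ind L) : flat (guard xs ys phi) = flat phi.
Proof. by elim: xs ys => [|x xs IH] [|y ys] /=. Qed.

Lemma guard_sat L (M : model L) (s : assignment M) xs ys (phi : ind L) :
  size xs = size ys ->
  flat_sat s (guard xs ys phi) <-> (map s xs = map s ys -> flat_sat s phi).
Proof.
elim: xs ys => [|x xs IH] [|y ys] //=; first by split=> [//|]; apply.
case=> /IH{}IH; rewrite IH; split=> [[xy [/xy//]|phis [_ /phis//]]|phis].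
have [xy|] := pselect (s x = s y); last by left.
by right=> xys; apply: phis; rewrite xy xys.
Qed.

Lemma guard_fv L xs ys (phi : ind L) (P : set var) :
  {in xs, forall x, P x} -> {in ys, forall x, P x} -> ind_fv phi `<=` P ->
  ind_fv (guard xs ys phi) `<=` P.
Proof.
move=> + + phiP; elim: xs ys => [|x xs IH] [|y ys] //= xP yP.
have {}IH : ind_fv (guard xs ys phi) `<=` P.
  by apply: IH => z zs; [apply: xP|apply: yP]; rewrite inE zs orbT.
by move=> z [[/= ->|/= ->]|/IH//]; [apply: xP|apply: yP]; rewrite mem_head.
Qed.

Arguments guard : simpl never.

Fixpoint ren_term L (r : var -> var) (t : term L) : term L :=
  match t with
  | Var x => Var L (r x)
  | App f ts => App f (fun i => ren_term r (ts i))
  end.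

Definition ren_atom L (r : var -> var) (a : atom L) : atom L :=
  match a with
  | Eq t u => Eq (ren_term r t) (ren_term r u)
  | Rel R ts => Rel R (fun i => ren_term r (ts i))
  end.

Lemma value_ren L (M : model L) (s : assignment M) r (t : term L) :
  value s (ren_term r t) = value (s \o r) t.
Proof.
by elim: t => //= f ts IH; congr (omap _ (all_def _)); apply/funext.
Qed.

Lemma atom_sat_ren L (M : model L) (s : assignment M) r (a : atom L) :
  atom_sat s (ren_atom r a) = atom_sat (s \o r) a.
Proof.
case: a => [t u|R ts] /=; first by rewrite !value_ren.
suff -> : (fun i => value s (ren_term r (ts i))) =
          (fun i => value (s \o r) (ts i)) by [].
by apply/funext => i; rewrite value_ren.
Qed.

Lemma term_fv_ren L (P : set var) r (t : term L) :
  (forall x, P (r x)) -> term_fv (ren_term r t) `<=` P.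
Proof.
move=> rP; elim: t => [x|f ts IH] /=; first by move=> y ->.
by move=> x [i _ /IH].
Qed.

Lemma atom_fv_ren L (P : set var) r (a : atom L) :
  (forall x, P (r x)) -> atom_fv (ren_atom r a) `<=` P.
Proof.
move=> rP; case: a => [t u|R ts] /= x; last by move=> [i _]; apply: term_fv_ren.
by case; apply: term_fv_ren.
Qed.

(* An application of the quantified function [oid] to the variables [oargs], the
   variable [oval] standing for its value. *)
Definition occ : Type := nat * nat * nat.
Definition oid (o : occ) := o.1.1.
Definition ost (o : occ) := o.1.2.
Definition oar (o : occ) := o.2.
Definition oargs (o : occ) := iota (ost o) (oar o).
Definition oval (o : occ) := ost o + oar o.

(** Each occurrence owns a block of consecutive variables, its arguments followed by its value, and
    the blocks increase from [n] to below [n']. Function indices obey the same bound because a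
    Skolem function is numbered by the first variable of its occurrence, so that one counter serves
    for both. *)
Fixpoint occs_wf (n : nat) (os : seq occ) (n' : nat) : bool :=
  if os is o :: os' then
    [&& n <= ost o, oid o < n' & occs_wf (oval o).+1 os' n']
  else n <= n'.

Definition respects T (E : nat -> seq T -> T) (rho : var -> T) (os : seq occ) :=
  forall o, o \in os -> rho (oval o) = E (oid o) (map rho (oargs o)).

Lemma respects_cons T (E : nat -> seq T -> T) rho o os :
  respects E rho (o :: os) <->
  rho (oval o) = E (oid o) (map rho (oargs o)) /\ respects E rho os.
Proof.
split=> [r|[ro r] o']; last by rewrite inE => /predU1P[->|/r].
by split=> [|o' o's]; apply: r; rewrite ?mem_head // inE o's orbT.
Qed.

Lemma respects_cat T (E : nat -> seq T -> T) rho os os' :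
  respects E rho (os ++ os') <-> respects E rho os /\ respects E rho os'.
Proof.
split=> [r|[r r'] o]; last by rewrite mem_cat => /orP[/r|/r'].
by split=> o os_o; apply: r; rewrite mem_cat os_o ?orbT.
Qed.

Lemma mem_oargs o x : (x \in oargs o) = (ost o <= x < oval o).
Proof. by rewrite mem_iota. Qed.

Lemma occs_wf_le n os n' : occs_wf n os n' -> n <= n'.
Proof.
elim: os n => //= o os IH n /and3P[no _ /IH]; rewrite /oval; lia.
Qed.

Lemma occs_wf_weaken n os n' n1 n1' :
  n1 <= n -> n' <= n1' -> occs_wf n os n' -> occs_wf n1 os n1'.
Proof.
elim: os n n1 => [|o os IH] n n1 /=; first lia.
move=> n1n n'n1' /and3P[no jo wf]; apply/and3P; split; [lia|lia|exact: IH wf].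
Qed.

Lemma occs_wf_cat n os n1 os' n2 :
  occs_wf n os n1 -> occs_wf n1 os' n2 -> occs_wf n (os ++ os') n2.
Proof.
elim: os n => [|o os IH] n /= wf wf'; first exact: occs_wf_weaken wf'.
have n12 := occs_wf_le wf'; move/and3P: wf => [no jo wf].
by apply/and3P; split; [|lia|exact: IH].
Qed.

Lemma occs_wf_bounds n os n' o :
  occs_wf n os n' -> o \in os -> [/\ n <= ost o, oid o < n' & oval o < n'].
Proof.
elim: os n => //= o' os IH n /and3P[no jo wf].
have le := occs_wf_le wf; rewrite inE => /predU1P[->//|/(IH _ wf)[lt jo' yo]].
by split=> //; rewrite /oval in lt; lia.
Qed.

Lemma respects_eq T (E E' : nat -> seq T -> T) (rho rho' : var -> T) n os n' :
  occs_wf n os n' -> agree n' E E' ->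
  (forall x, n <= x < n' -> rho x = rho' x) ->
  respects E rho os -> respects E' rho' os.
Proof.
move=> wf EE' rr' r o os_o; have [no jo yo] := occs_wf_bounds wf os_o.
have yb : n <= oval o < n' by rewrite /oval in yo *; lia.
rewrite -(rr' _ yb) r // EE' //.
congr (E _ _); apply/eq_in_map => x; rewrite mem_oargs => xo.
by apply: rr'; rewrite /oval in xo yo *; lia.
Qed.

(** Values are filled in from left to right: an occurrence reads only its own argument variables,
    and later ones change neither these nor its value. *)
Lemma respects_ex T (E : nat -> seq T -> T) (rho : var -> T) n os n' :
  occs_wf n os n' ->
  exists rho', respects E rho' os /\
    forall x, x \notin map oval os -> rho' x = rho x.
Proof.
elim: os n rho => [|o os IH] n rho /=; first by exists rho.
move=> /and3P[no jo wf].
have [rho' [r rr']] := IH _ [eta rho with oval o |->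
  E (oid o) (map rho (oargs o))] wf.
have out x : x <= oval o -> x \notin map oval os.
  move=> xo; apply/mapP => -[o' os_o' xE].
  by have [lt _ _] := occs_wf_bounds wf os_o'; rewrite /oval in lt xE xo; lia.
exists rho'; split=> [|x]; last first.
  by rewrite inE negb_or => /andP[/negbTE xo /rr'] /=; rewrite xo.
apply/respects_cons; split=> //; rewrite rr' ?out //= eqxx.
congr (E _ _); apply/eq_in_map => x; rewrite mem_oargs => /andP[_ xo].
by rewrite rr' /= ?ltn_eqF ?out // ltnW.
Qed.

(* [U] lists the variables that replace the levels in scope, and the variables
   from [n] on are fresh. Since a level out of range denotes the default value,
   that value is kept in the variable [x0], on which Skolem functions depend. *)
Fixpoint skolem L (x0 : var) (pol : bool) (U : seq var) (n : nat) (p : sf L) :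
    nat * seq occ * ind L :=
  match p with
  | SLit a =>
      let a' := ren_atom (nth x0 U) a in
      (n, [::], if pol then Pos a' else Neg a')
  | SFun j zs y =>
      let o : occ := (j, n, size zs) in
      let y' := nth x0 U y in
      ((oval o).+1, [:: o],
       guard (oargs o) (map (nth x0 U) zs)
         (if pol then eqv L (oval o) y' else neqv L (oval o) y'))
  | SNot q => skolem x0 (~~ pol) U n q
  | SAnd q r =>
      let: (n1, os1, t1) := skolem x0 pol U n q in
      let: (n2, os2, t2) := skolem x0 pol U n1 r in
      (n2, os1 ++ os2, if pol then And t1 t2 else Or t1 t2)
  | SEx q =>
      if pol then
        let o : occ := (n, n, (size U).+1) in
        let: (n1, os, t) := skolem x0 pol (rcons U (oval o)) (oval o).+1 q in
        (n1, o :: os, guard (oargs o) (x0 :: U) t)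
      else skolem x0 pol (rcons U n) n.+1 q
  end.

(** A strict bound on the function indices in [p]; from there on indices are free for Skolem
    functions. *)
Fixpoint sf_ids L (p : sf L) : nat :=
  match p with
  | SLit _ => 0
  | SFun j _ _ => j.+1
  | SNot q | SEx q => sf_ids q
  | SAnd q r => maxn (sf_ids q) (sf_ids r)
  end.

Lemma sf_sat_agree L (M : model L) E E' (m0 : M) e (p : sf L) n :
  sf_ids p <= n -> agree n E E' -> sf_sat E' m0 e p <-> sf_sat E m0 e p.
Proof.
move=> + EE'; elim: p e => //= [j zs y|p IH|p IHp q IHq|p IH] e.
- by move=> jn; rewrite EE'.
- by move=> /IH->.
- by rewrite geq_max => /andP[/IHp-> /IHq->].
- by move=> /IH{}IH; split=> -[m /IH]; exists m.
Qed.

Lemma nth_mem_range (N n : nat) (x0 : var) (U : seq var) i :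
  N <= x0 < n -> {in U, forall x, N <= x < n} -> N <= nth x0 U i < n.
Proof.
move=> x0n Un; have [lt|le] := ltnP i (size U); last by rewrite nth_default.
exact/Un/mem_nth.
Qed.

Lemma in_rcons_range (N n n' : nat) (U : seq var) (y : var) :
  N <= y < n' -> n <= n' -> {in U, forall x, N <= x < n} ->
  {in rcons U y, forall x, N <= x < n'}.
Proof.
move=> yn nn' Un x; rewrite mem_rcons inE => /predU1P[->//|/Un]; lia.
Qed.

(** The lower bound [N] will keep the variables of the Skolem form apart from the tuple of variables
    whose relation is described. *)
Lemma skolem_wf L (N : nat) (x0 : var) pol (U : seq var) n (p : sf L) :
  sf_ids p <= n -> N <= x0 < n -> {in U, forall x, N <= x < n} ->
  let: (n', os, t) := skolem x0 pol U n p in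
  [/\ occs_wf n os n', flat t & forall x, ind_fv t x -> N <= x < n'].
Proof.
elim: p pol U n => [a|j zs y|p IH|p IHp q IHq|p IH] pol U n /= idn x0n Un.
- split=> [||x]; [exact: leqnn|by case: pol|].
  have h : atom_fv (ren_atom (nth x0 U) a) `<=` [set x | N <= x < n].
    by apply: atom_fv_ren => i; apply: nth_mem_range.
  by case: pol => /h.
- split; first by rewrite /oval /oid /ost /oar /=; lia.
    by rewrite flat_guard; case: pol.
  apply: guard_fv => [x|x /mapP[z _ ->]|x];
    rewrite /= ?mem_oargs /oval /ost /oar /=.
  + by lia.
  + by have := nth_mem_range z x0n Un; lia.
  + have := nth_mem_range y x0n Un.
    by case: pol => /= h [] /= ->; lia.
- exact: IH.
- rewrite geq_max in idn; move/andP: idn => [idp idq].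
  have := IHp pol U n idp x0n Un; case: skolem => -[n1 os1] t1 [wf1 fl1 fv1].
  have nn1 := occs_wf_le wf1.
  have := IHq pol U n1 (leq_trans idq nn1).
  case: skolem => -[n2 os2] t2 [||wf2 fl2 fv2].
    by lia.
    by move=> x /Un; lia.
  have n12 := occs_wf_le wf2.
  split; first exact: occs_wf_cat wf2.
    by case: pol; rewrite /= fl1.
  by case: pol => x /= [/fv1|/fv2]; lia.
- case: pol; last first.
    have := IH false (rcons U n) n.+1.
    case: skolem => -[n' os] t [|||wf fl fv]; [lia|lia|by apply: in_rcons_range Un; lia|].
    by split=> //; apply: occs_wf_weaken wf.
  set o : occ := (n, n, (size U).+1).
  have oE : oval o = n + (size U).+1 by [].
  have := IH true (rcons U (oval o)) (oval o).+1.
  case: skolem => -[n' os] t [|||wf fl fv]; [lia|lia|by apply: in_rcons_range Un; lia|].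
  have le := occs_wf_le wf; rewrite oE in le.
  split; first by rewrite /= leqnn wf /oid /= andbT; lia.
    by rewrite flat_guard.
  apply: guard_fv => // x; first by rewrite mem_oargs oE (_ : ost o = n) //=; lia.
  by rewrite inE => /predU1P[->|/Un] /=; lia.
Qed.

Definition tot T (rho : var -> T) : assignment T := fun x => Some (rho x).

Definition signed (pol : bool) (P : Prop) : Prop := if pol then P else ~ P.

Lemma map_tot T (rho : var -> T) xs ys :
  map (tot rho) xs = map (tot rho) ys <-> map rho xs = map rho ys.
Proof.
have E zs : map (tot rho) zs = map Some (map rho zs) by rewrite -map_comp.
by rewrite !E; split=> [/inj_map|->//]; apply; move=> x y [].
Qed.

Lemma nth_map_default T (rho : var -> T) x0 U i :
  nth (rho x0) (map rho U) i = rho (nth x0 U i).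
Proof.
have [lt|le] := ltnP i (size U); first exact: nth_map.
by rewrite !nth_default ?size_map.
Qed.

Lemma guard_sat_tot L (M : model L) (rho : var -> M) xs ys (phi : ind L) :
  size xs = size ys ->
  flat_sat (tot rho) (guard xs ys phi) <->
  (map rho xs = map rho ys -> flat_sat (tot rho) phi).
Proof. by move=> /guard_sat->; rewrite map_tot. Qed.

Lemma skolem_lit L (M : model L) E (rho : var -> M) x0 pol U (a : atom L) :
  flat_sat (tot rho) (if pol then Pos (ren_atom (nth x0 U) a)
                      else Neg (ren_atom (nth x0 U) a)) <->
  signed pol (sf_sat E (rho x0) (map rho U) (SLit a)).
Proof.
have -> : sf_sat E (rho x0) (map rho U) (SLit a) =
          atom_sat (tot rho) (ren_atom (nth x0 U) a).
  rewrite atom_sat_ren /=; congr (atom_sat _ a).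
  by apply/funext => x; rewrite /tot /= nth_map_default.
by case: pol.
Qed.

Lemma sf_sat_fun L (M : model L) E (rho : var -> M) x0 U j zs y :
  sf_sat E (rho x0) (map rho U) (@SFun L j zs y) =
  (E j (map rho (map (nth x0 U) zs)) = rho (nth x0 U y)).
Proof.
rewrite /= nth_map_default -map_comp; congr (E j _ = _).
by apply: eq_map => z /=; rewrite nth_map_default.
Qed.

(** Skolem functions are chosen once for all [rho]. An existential at negative polarity is a
    universal, and its variable simply stays free; at positive polarity a new function is added,
    which does not affect the truth of [p], whose indices lie below [n]. *)
Lemma skolem_complete L (M : model L) (x0 : var) pol (U : seq var) n (p : sf L) E :
  sf_ids p <= n -> x0 < n -> {in U, forall x, x < n} ->
  let: (n', os, t) := skolem x0 pol U n p in
  exists E', agree n E E' /\ forall rho : var -> M,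
    signed pol (sf_sat E (rho x0) (map rho U) p) -> respects E' rho os ->
    flat_sat (tot rho) t.
Proof.
elim: p pol U n E => [a|j zs y|p IH|p IHp q IHq|p IH] pol U n E idn x0n Un.
- by exists E; split=> // rho /skolem_lit.
- rewrite [skolem _ _ _ _ _]/=; exists E; split=> // rho.
  rewrite sf_sat_fun => sg /respects_cons[r _].
  apply/guard_sat_tot; rewrite ?size_iota ?size_map // => argsE.
  rewrite -argsE -[E j _]r in sg.
  by case: pol sg => /= [valE|neq [/neq]] //; congr Some.
- have := IH (~~ pol) U n E idn x0n Un => /=.
  case: skolem => -[n' os] t [E' [EE' h]]; exists E'; split=> // rho sg.
  by apply: h; case: pol sg => //= /contrapT.
- rewrite /= geq_max in idn; move/andP: idn => [idp idq] /=.
  have := IHp pol U n E idp x0n Un.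
  have := @skolem_wf L 0 x0 pol U n p idp x0n Un.
  case: skolem => -[n1 os1] t1 [wf1 _ _] [E1 [EE1 h1]].
  have nn1 := occs_wf_le wf1.
  have x0n1 : x0 < n1 by lia.
  have Un1 : {in U, forall x, x < n1} by move=> x /Un; lia.
  have := IHq pol U n1 E1 (leq_trans idq nn1) x0n1 Un1.
  case: skolem => -[n2 os2] t2 [E2 [E12 h2]].
  exists E2; split=> [|rho sg /respects_cat[r1 r2]].
    exact: agree_trans E12.
  have {}r1 : respects E1 rho os1.
    by apply: respects_eq r1 => //; [exact: wf1|move=> j /E12].
  have q1 := sf_sat_agree (rho x0) (map rho U) idq EE1.
  case: pol sg h1 h2 => /= sg h1 h2.
    by split; [apply: h1 => //; case: sg|apply: h2 => //; apply/q1; case: sg].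
  have [np|/contrapT px] := pselect (~ sf_sat E (rho x0) (map rho U) p).
    by left; apply: h1.
  by right; apply: h2 => // /q1 qx; apply: sg.
- case: pol; rewrite [skolem _ _ _ _ _]/=; last first.
    have := IH false (rcons U n) n.+1 E (leqW idn) (leqW x0n).
    case: skolem => -[n' os] t [|E' [EE' h]].
      by move=> x; rewrite mem_rcons inE => /predU1P[->//|/Un]; lia.
    exists E'; split=> [j jn|rho sg]; first by apply: EE'; apply: ltnW.
    by apply: h => /= px; apply: sg; exists (rho n); rewrite -map_rcons.
  set o : occ := (n, n, (size U).+1).
  have oE : oval o = n + (size U).+1 by [].
  have [m1 _] := two_elements M.
  (* [g] receives the default value followed by the values in scope, and returns a witness whenever
     there is one. *)
  have /choice[g gP] (l : seq M) : exists m,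
      (exists m', sf_sat E (head m1 l) (rcons (behead l) m') p) ->
      sf_sat E (head m1 l) (rcons (behead l) m) p.
    have [[m pm]|np] := pselect (exists m',
      sf_sat E (head m1 l) (rcons (behead l) m') p); first by exists m.
    by exists m1 => /np.
  have := IH true (rcons U (oval o)) (oval o).+1 [eta E with n |-> g].
  case: skolem => -[n' os] t [|||E' [EE' h]]; [by move: idn => /=; lia|lia| |].
    by move=> x; rewrite mem_rcons inE => /predU1P[->//|/Un]; lia.
  exists E'; split=> [|rho sg /respects_cons[ro r]].
    by apply: agree_trans EE'; [lia|exact: agree_set].
  apply/guard_sat_tot; first by rewrite size_iota.
  move=> argsE; apply: h => //; rewrite /signed.
  apply/(sf_sat_agree (p := p) _ _ idn (@agree_set _ _ E g)).
  have := gP (rho x0 :: map rho U) sg.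
  by rewrite map_rcons ro argsE EE' /= ?eqxx // /oid /=; lia.
Qed.

Lemma occ_ex T (E : nat -> seq T -> T) (rho : var -> T) (o : occ) l :
  size l = oar o ->
  exists rho', [/\ forall x, x < ost o -> rho' x = rho x,
    map rho' (oargs o) = l & rho' (oval o) = E (oid o) l].
Proof.
move=> sl; pose b := E (oid o) l.
(* The value variable is the position just after the arguments, so the default [b] of [nth] lands
   there. *)
exists (fun x => if x < ost o then rho x else nth b l (x - ost o)); split.
- by move=> x ->.
- apply: (@eq_from_nth _ b) => [|i]; rewrite size_map size_iota ?sl // => io.
  by rewrite (nth_map 0) ?size_iota // nth_iota // ltnNge leq_addr /= addKn.
- by rewrite ltnNge leq_addr /= addKn nth_default ?sl.
Qed.

(** The contrapositive form lets the induction build a counterexample: whatever functions [E] offers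
    as Skolem functions, the fresh variables are given values that make the Skolem form fail. *)
Lemma skolem_sound L (M : model L) (x0 : var) pol (U : seq var) n (p : sf L) E
    (rho : var -> M) :
  sf_ids p <= n -> x0 < n -> {in U, forall x, x < n} ->
  ~ signed pol (sf_sat E (rho x0) (map rho U) p) ->
  let: (n', os, t) := skolem x0 pol U n p in
  exists rho' : var -> M, [/\ forall x, x < n -> rho' x = rho x,
    respects E rho' os & ~ flat_sat (tot rho') t].
Proof.
have map_same (rho1 rho2 : var -> M) (V : seq var) m :
    {in V, forall x, x < m} ->
    (forall x, x < m -> rho1 x = rho2 x) -> map rho1 V = map rho2 V.
  by move=> Vm h; apply/eq_in_map => x /Vm /h.
elim: p pol U n rho => [a|j zs y|p IH|p IHp q IHq|p IH] pol U n rho idn x0n Un.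
- by move=> sg; exists rho; split=> // /skolem_lit.
- rewrite sf_sat_fun [skolem _ _ _ _ _]/= => sg.
  set o : occ := (j, n, size zs).
  have Um z : nth x0 U z < n by apply: (@nth_mem_range 0).
  have [|rho' [rr' argsE valE]] :=
    @occ_ex _ E rho o (map rho (map (nth x0 U) zs)); first by rewrite !size_map.
  exists rho'; split=> //.
    by apply/respects_cons; split=> //; rewrite argsE.
  have zsE : map rho' (map (nth x0 U) zs) = map rho (map (nth x0 U) zs).
    by apply: map_same rr' => _ /mapP[z _ ->].
  rewrite guard_sat_tot ?size_iota ?size_map // argsE zsE => /(_ erefl).
  case: pol sg => /= sg; first by case; rewrite valE rr'.
  by move=> h; apply: h; rewrite /tot valE rr' //; congr Some; apply: contrapT.
- move=> sg; have := IH (~~ pol) U n rho idn x0n Un.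
  rewrite /=; case: skolem => -[n' os] t; apply.
  by case: pol sg => //= sg pU; apply: sg; apply.
- rewrite /= geq_max in idn; move/andP: idn => [idp idq] sg.
  have ext1 := IHp pol U n _ idp x0n Un; rewrite /=.
  have := @skolem_wf L 0 x0 pol U n p idp x0n Un.
  case: skolem ext1 => -[n1 os1] t1 ext1 [wf1 _ fv1].
  have nn1 := occs_wf_le wf1.
  have x0n1 : x0 < n1 by lia.
  have Un1 : {in U, forall x, x < n1} by move=> x /Un; lia.
  have ext2 := IHq pol U n1 _ (leq_trans idq nn1) x0n1 Un1.
  have := @skolem_wf L 0 x0 pol U n1 q (leq_trans idq nn1) x0n1 Un1.
  case: skolem ext2 => -[n2 os2] t2 ext2 [wf2 _ fv2].
  have keep1 rho1 rho2 : (forall x, x < n1 -> rho2 x = rho1 x) ->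
      respects E rho1 os1 -> respects E rho2 os1 /\
      flat_sat (tot rho2) t1 = flat_sat (tot rho1) t1.
    move=> h r1; split; last first.
      by apply: flat_sat_eq => x /fv1 xn1; rewrite /tot h.
    by apply: respects_eq r1 => //; [exact: wf1|move=> x xn1; rewrite h //; lia].
  (* Even where this part need not fail, its occurrences must be respected. The implication covers
     both cases, so conjunctions and disjunctions are treated together. *)
  have some1 : exists rho1, [/\ forall x, x < n -> rho1 x = rho x,
      respects E rho1 os1 & ~ signed pol (sf_sat E (rho x0) (map rho U) p) ->
      ~ flat_sat (tot rho1) t1].
    have [sp|/ext1[rho1 [rr1 r1 nt1]]] :=
        pselect (signed pol (sf_sat E (rho x0) (map rho U) p)).
      have [rho1 [r1 rr1]] := respects_ex E rho wf1.
      exists rho1; split=> // x xn; apply: rr1; apply/mapP => -[o os_o xE].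
      have [no _ _] := occs_wf_bounds wf1 os_o.
      by rewrite xE /oval in xn; lia.
    by exists rho1.
  have [rho1 [rr1 r1 nt1]] := some1.
  have qE : sf_sat E (rho1 x0) (map rho1 U) q = sf_sat E (rho x0) (map rho U) q.
    by rewrite rr1 // (map_same _ rho _ n).
  have some2 : exists rho2, [/\ forall x, x < n1 -> rho2 x = rho1 x,
      respects E rho2 os2 & ~ signed pol (sf_sat E (rho x0) (map rho U) q) ->
      ~ flat_sat (tot rho2) t2].
    have [sq|nsq] := pselect (signed pol (sf_sat E (rho x0) (map rho U) q)).
      have [rho2 [r2 rr2]] := respects_ex E rho1 wf2.
      exists rho2; split=> // x xn; apply: rr2; apply/mapP => -[o os_o xE].
      have [no _ _] := occs_wf_bounds wf2 os_o.
      by rewrite xE /oval in xn; lia.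
    by have [|rho2 [rr2 r2 nt2]] := ext2 rho1; [rewrite qE|exists rho2].
  have [rho2 [rr2 r2 nt2]] := some2.
  have [r1' t1E] := keep1 _ _ rr2 r1.
  exists rho2; split; [by move=> x xn; rewrite rr2 ?rr1 //; lia| |].
    exact/respects_cat.
  case: pol sg nt1 nt2 {ext1 ext2 some1 some2 keep1} => /= sg nt1 nt2.
    rewrite t1E => -[sat1 sat2].
    by apply: sg; split; apply: contrapT; [move/nt1|move/nt2].
  rewrite t1E; move/contrapT: sg => -[sp sq].
  by case; [apply: nt1|apply: nt2]; apply.
- case: pol => sg; rewrite [skolem _ _ _ _ _]/=; last first.
    move/contrapT: sg => -[m pm].
    pose rho1 := [eta rho with n |-> m].
    have rr1 x : x < n -> rho1 x = rho x by move=> xn; rewrite /rho1 /= ltn_eqF.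
    have := IH false (rcons U n) n.+1 rho1 (leqW idn) (leqW x0n).
    case: skolem => -[n' os] t [||rho2 [rr2 r2 nt2]].
    + by move=> x; rewrite mem_rcons inE => /predU1P[->//|/Un]; lia.
    + move=> h; apply: h.
      by rewrite map_rcons rr1 // (map_same _ rho _ n) // /rho1 /= eqxx.
    + by exists rho2; split=> // x xn; rewrite rr2 ?rr1 //; lia.
  set o : occ := (n, n, (size U).+1).
  have oE : oval o = n + (size U).+1 by [].
  (* The arguments are the default and the values in scope, so the guard applies; the value proposed
     by [E] is no witness, as there is none. *)
  have [|rho1 [rr1 argsE valE]] :=
    @occ_ex _ E rho o (rho x0 :: map rho U); first by rewrite /= size_map.
  have := IH true (rcons U (oval o)) (oval o).+1 rho1.
  have := @skolem_wf L 0 x0 true (rcons U (oval o)) (oval o).+1 p.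
  have x0U : map rho1 (x0 :: U) = rho x0 :: map rho U.
    by rewrite /= rr1 // (map_same _ rho _ n).
  have Un1 : {in rcons U (oval o), forall x, x < (oval o).+1}.
    by move=> x; rewrite mem_rcons inE => /predU1P[->//|/Un]; lia.
  case: skolem => -[n' os] t [|||wf _ fv]; [by move: idn => /=; lia|lia|by []|].
  case=> [|||| rho2 [rr2 r2 nt2]]; [by move: idn => /=; lia|lia|by []| |].
    move=> pm; apply: sg; exists (rho1 (oval o)); move: pm.
    rewrite /= map_rcons; move: x0U => /= -[-> ->]; exact.
  have argsE2 : map rho2 (oargs o) = map rho1 (oargs o).
    by apply: map_same rr2 => x; rewrite mem_oargs; lia.
  exists rho2; split.
  + by move=> x xn; rewrite rr2 ?rr1 //; lia.
  + by apply/respects_cons; split=> //; rewrite rr2 // argsE2 argsE.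
  + rewrite guard_sat_tot ?size_iota // => h; apply: nt2; apply: h.
    rewrite argsE2 argsE -x0U; apply/esym/(map_same _ _ _ (oval o).+1) => //.
    by move=> x; rewrite inE => /predU1P[->|/Un]; lia.
Qed.

(** * Functions in teams *)

Definition extends D (s r : assignment D) (xs : seq var) : Prop :=
  (forall x, x \notin xs -> r x = s x) /\
  (forall x, x \in xs -> exists m, r x = Some m).

Lemma extends_nil D (s r : assignment D) : extends s r [::] <-> r = s.
Proof.
by split=> [[rs _]|->]; [apply/funext => x; apply: rs|split].
Qed.

Lemma extends_cons D (s r : assignment D) x xs :
  extends s r (x :: xs) <-> exists m, extends (upd s x m) r xs.
Proof.
split=> [[rs rd]|[m [rs rd]]].
  have [m rx] := rd x (mem_head _ _); exists m.
  split=> y; last by move=> yxs; apply: rd; rewrite inE yxs orbT.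
  rewrite /upd /=; case: eqVneq => [->//|yx] yxs.
  by apply: rs; rewrite inE negb_or yx.
split=> y; first by rewrite inE negb_or => /andP[/negbTE yx /rs]; rewrite /upd /= yx.
rewrite inE; have [/rd//|/rs ry] := boolP (y \in xs).
by rewrite orbF => /eqP yx; exists m; rewrite ry yx /upd /= eqxx.
Qed.

Lemma sat_alls L (M : model L) (X : set (assignment M)) us (phi : ind L) :
  ind_sat X (foldr (@All L) phi us) <->
  ind_sat [set r | exists2 s, X s & extends s r us] phi.
Proof.
elim: us X => [|x us IH] X /=.
  suff -> : [set r | exists2 s, X s & extends s r [::]] = X by [].
  apply/seteqP; split=> [r [s Xs /extends_nil->//]|r Xr].
  by exists r => //; apply/extends_nil.
rewrite IH; set Y := (X in ind_sat X _); set Z := (X in _ <-> ind_sat X _).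
suff -> : Y = Z by [].
apply/seteqP; split=> r; first by move=> [_ [s [m [Xs ->]]] e]; exists s => //;
  apply/extends_cons; exists m.
by move=> [s Xs /extends_cons[m e]]; exists (upd s x m) => //; exists s, m.
Qed.

(** In lax semantics the function [H] can be replaced by the supplemented team: given [Y], a
    suitable [H s] is the set of all [m] with [Y (upd s x m)]. *)
Lemma sat_ex L (M : model L) (X : set (assignment M)) x (phi : ind L) :
  ind_sat X (Ex x phi) <->
  exists Y, [/\ ind_sat Y phi,
    forall r, Y r -> exists s m, X s /\ r = upd s x m &
    forall s, X s -> exists m, Y (upd s x m)].
Proof.
split=> [/= [H [Hne sat]]|[Y [sat YX XY]]] /=.
  exists (supplement X H x); split=> // [r [s [m [Xs _ ->]]]|s Xs].
    by exists s, m.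
  by have [m Hm] := Hne s Xs; exists m, s, m.
exists (fun s m => Y (upd s x m)); split=> [s /XY//|].
suff -> : supplement X (fun s m => Y (upd s x m)) x = Y by [].
apply/seteqP; split=> r; first by move=> [s [m [_ + ->]]].
by move=> Yr; have [s [m [Xs rE]]] := YX r Yr; exists s, m; split; rewrite -?rE.
Qed.

Lemma sat_exs L (M : model L) (X : set (assignment M)) ys (phi : ind L) :
  ind_sat X (foldr (@Ex L) phi ys) <->
  exists Y, [/\ ind_sat Y phi,
    forall r, Y r -> exists2 s, X s & extends s r ys &
    forall s, X s -> exists2 r, Y r & extends s r ys].
Proof.
elim: ys X => [|y ys IH] X.
  split=> [sat|[Y [sat YX XY]]].
    by exists X; split=> // r Xr; exists r => //; apply/extends_nil.
  suff -> : X = Y by [].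
  apply/seteqP; split=> r; first by move=> /XY[s Ys /extends_nil<-].
  by move=> /YX[s Xs /extends_nil->].
rewrite [foldr _ _ _]/= sat_ex; split=> [[Z [/IH[Y [sat YZ ZY]] ZX XZ]]|].
  exists Y; split=> // [r /YZ[t Zt e]|s /XZ[m /ZY[r Yr e]]].
    have [s [m [Xs tE]]] := ZX _ Zt; exists s => //.
    by apply/extends_cons; exists m; rewrite -tE.
  by exists r => //; apply/extends_cons; exists m.
move=> [Y [sat YX XY]].
(* The intermediate team keeps those updates at [y] that some row of [Y] extends. *)
exists [set t | (exists s m, X s /\ t = upd s y m) /\
  exists2 r, Y r & extends t r ys]; split=> [|t []//|s Xs].
  apply/IH; exists Y; split=> // [r Yr|t [_]//].
  have [s Xs /extends_cons[m e]] := YX r Yr.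
  by exists (upd s y m) => //; split; [exists s, m|exists r].
have [r Yr /extends_cons[m e]] := XY s Xs.
by exists m; split; [exists s, m|exists r].
Qed.

(** * Functional dependence within a team *)

Definition ands L (I : Type) (x : var) (F : I -> ind L) (l : seq I) : ind L :=
  foldr (fun i => And (F i)) (eqv L x x) l.

Lemma sat_ands L (M : model L) (X : set (assignment M)) (I : eqType) x
    (F : I -> ind L) l :
  ind_sat X (ands x F l) <-> forall i, i \in l -> ind_sat X (F i).
Proof.
elim: l => [|i l IH] /=; first by split=> // _ s _ /=.
rewrite IH; split=> [[Fi Fl] j|Fl]; first by rewrite inE => /predU1P[->|/Fl].
by split=> [|j jl]; apply: Fl; rewrite inE ?eqxx ?jl ?orbT.
Qed.

Lemma ands_fv L (I : eqType) x (F : I -> ind L) l (P : set var) :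
  P x -> (forall i, i \in l -> ind_fv (F i) `<=` P) -> ind_fv (ands x F l) `<=` P.
Proof.
move=> Px; elim: l => [|i l IH] FP /= y; first by case=> ->.
case=> [|ly]; first by apply: FP; rewrite mem_head.
by apply: IH ly => j jl; apply: FP; rewrite inE jl orbT.
Qed.

(** The dependence atom [=(xs, y)]: [y] is independent of itself given [xs]. *)
Definition dep L (xs : seq var) (y : var) : ind L :=
  Indep [:: Var L y] [seq Var L x | x <- xs] [:: Var L y].

Lemma values_vars L (M : model L) (s : assignment M) xs :
  values s [seq Var L x | x <- xs] = map s xs.
Proof. by rewrite /values -map_comp. Qed.

Lemma values_cat L (M : model L) (s : assignment M) ts us :
  values s (ts ++ us) = values s ts ++ values s us.
Proof. exact: map_cat. Qed.

Lemma sat_dep L (M : model L) (X : set (assignment M)) xs y :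
  ind_sat X (dep L xs y) <->
  forall s s', X s -> X s' -> map s xs = map s' xs -> s y = s' y.
Proof.
rewrite /dep /=; split=> h s s' Xs Xs'.
  move=> ss'; have := h s s' Xs Xs'; rewrite !values_vars => /(_ ss')[t [_]].
  rewrite !values_cat !values_vars => /(congr1 (last None)) + /(congr1 (last None)).
  by rewrite !last_cat /= => <- <-.
rewrite !values_vars => ss'; exists s; split=> //.
by rewrite !values_cat !values_vars ss' /= (h s s').
Qed.

Lemma terms_fv_vars L xs : terms_fv [seq Var L x | x <- xs] = [set` xs].
Proof.
rewrite /terms_fv; elim: xs => [|x xs IH] /=.
  by rewrite big_nil; apply/seteqP; split.
rewrite big_cons IH; apply/seteqP; split=> y /=; rewrite inE.
  by case=> [->|->]; rewrite ?eqxx ?orbT.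
by case/predU1P => [->|ys]; [left|right].
Qed.

Lemma dep_fv L xs y (P : set var) :
  P y -> {in xs, forall x, P x} -> ind_fv (dep L xs y) `<=` P.
Proof.
move=> Py xP z; rewrite /dep /= terms_fv_vars.
rewrite -[[:: Var L y]]/[seq Var L x | x <- [:: y]] terms_fv_vars.
have h : z \in [:: y] -> P z by rewrite inE => /eqP->.
by case=> [[/xP|/h]|/h].
Qed.

(** A row by row condition linking two occurrences of one function. Argument lists of different
    lengths never coincide, so such pairs get a trivially true formula. *)
Definition consistent L (x : var) (o o' : occ) : ind L :=
  if (oid o == oid o') && (oar o == oar o') then
    guard (oargs o) (oargs o') (eqv L (oval o) (oval o'))
  else eqv L x x.

Definition functional L (x : var) (os : seq occ) : ind L :=
  And (ands x (fun o => dep L (oargs o) (oval o)) os)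
      (ands x (fun o => ands x (consistent L x o) os) os).

Lemma functional_fv L x n os n' (P : set var) :
  occs_wf n os n' -> P x -> (forall y, n <= y < n' -> P y) ->
  ind_fv (functional L x os) `<=` P.
Proof.
move=> wf Px Pn.
have argsP o : o \in os -> {in oargs o, forall y, P y}.
  move=> /(occs_wf_bounds wf)[no _ yo] y; rewrite mem_oargs => yargs.
  by apply: Pn; lia.
have valP o : o \in os -> P (oval o).
  by move=> /(occs_wf_bounds wf)[no _ yo]; apply: Pn; rewrite /oval in yo *; lia.
rewrite /functional => y [|].
  apply: ands_fv => // o os_o.
  by apply: dep_fv; [exact: valP|exact: argsP].
apply: ands_fv => // o os_o; apply: ands_fv => // o' os_o'; rewrite /consistent.
case: ifP => _; last by move=> z [] ->.
apply: guard_fv; [exact: argsP|exact: argsP|].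
by move=> z [] /= ->; exact: valP.
Qed.

Lemma occs_disjoint n os n' o o' :
  occs_wf n os n' -> o \in os -> o' \in os ->
  [\/ o = o', oval o < ost o' | oval o' < ost o].
Proof.
elim: os n => //= o1 os IH n /and3P[_ _ wf].
rewrite !inE => /predU1P[->|os_o] /predU1P[->|os_o'].
- by constructor 1.
- by constructor 2; have [] := occs_wf_bounds wf os_o'.
- by constructor 3; have [] := occs_wf_bounds wf os_o.
- exact: (IH _ wf).
Qed.

(** Distinct occurrences use disjoint variables, so both argument lists can be prescribed at
    once. *)
Lemma oargs_eq_ex T n os n' (o o' : occ) (a : seq T) (m0 : T) :
  occs_wf n os n' -> o \in os -> o' \in os -> oar o = oar o' -> size a = oar o ->
  exists rho : var -> T, map rho (oargs o) = a /\ map rho (oargs o') = a.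
Proof.
move=> wf os_o os_o' oo' sa.
exists (fun x => nth m0 a (x - if x \in oargs o then ost o else ost o')).
split; apply: (@eq_from_nth _ m0) => [|i]; rewrite size_map size_iota ?sa // => ia.
  rewrite (nth_map 0) ?size_iota // nth_iota // mem_oargs leq_addr /oval.
  by rewrite ltn_add2l ia addKn.
rewrite (nth_map 0) ?size_iota // nth_iota // mem_oargs.
case: (occs_disjoint wf os_o os_o') => [->|lt|lt].
- by rewrite if_same addKn.
- by rewrite ifF ?addKn //; apply/negbTE; rewrite /oval in lt *; lia.
- by rewrite ifF ?addKn //; apply/negbTE; rewrite /oval in lt *; lia.
Qed.

(** Dependence makes the value of each occurrence a function of its arguments throughout [T]. To
    compare two occurrences in different rows, fullness gives a third row where both have the
    arguments [a]; dependence carries the values there, and [consistent] identifies them. *)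
Lemma functional_sound L (M : model L) (T : set (assignment M)) x n os n' :
  occs_wf n os n' ->
  (forall r o, T r -> o \in os -> exists m, r (oval o) = Some m) ->
  (forall rho : var -> M, exists2 r, T r &
     forall o, o \in os -> map r (oargs o) = map Some (map rho (oargs o))) ->
  ind_sat T (functional L x os) ->
  exists E : nat -> seq M -> M, forall r o a, T r -> o \in os ->
    map r (oargs o) = map Some a -> r (oval o) = Some (E (oid o) a).
Proof.
move=> wf Tdef Tfull [/sat_ands Tdep /sat_ands Tcons].
have [m1 _] := two_elements M.
have uniq_val r r' o o' a : T r -> T r' -> o \in os -> o' \in os ->
    oid o = oid o' -> map r (oargs o) = map Some a ->
    map r' (oargs o') = map Some a -> r (oval o) = r' (oval o').
  move=> Tr Tr' os_o os_o' jj' ra r'a.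
  have so : size a = oar o.
    by have := congr1 size ra; rewrite !size_map size_iota.
  have so' : size a = oar o'.
    by have := congr1 size r'a; rewrite !size_map size_iota.
  have [|rho [rhoo rhoo']] := oargs_eq_ex m1 wf os_o os_o' _ so; first by rewrite -so.
  have [t Tt tE] := Tfull rho.
  have -> : r (oval o) = t (oval o).
    by move/sat_dep: (Tdep o os_o); apply=> //; rewrite tE // rhoo.
  have -> : r' (oval o') = t (oval o').
    by move/sat_dep: (Tdep o' os_o'); apply=> //; rewrite tE // rhoo'.
  have /sat_ands/(_ _ os_o') := Tcons o os_o.
  rewrite /consistent jj' eqxx -so so' eqxx /= => /flatP.
  rewrite flat_guard => /(_ erefl _ Tt) /guard_sat; rewrite !size_iota -so so'.
  by apply=> //; rewrite !tE // rhoo rhoo'.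
(* [E] takes the common value at indices and arguments that occur in [T]; elsewhere [m1] will do. *)
have /choice[E EP] (ja : nat * seq M) : exists m, forall r o, T r -> o \in os ->
    oid o = ja.1 -> map r (oargs o) = map Some ja.2 -> r (oval o) = Some m.
  case: ja => j a /=.
  have [[r [o [Tr os_o jE ra]]]|none] := pselect (exists r o,
    [/\ T r, o \in os, oid o = j & map r (oargs o) = map Some a]); last first.
    by exists m1 => r o Tr os_o jE ra; case: none; exists r, o.
  have [m rm] := Tdef r o Tr os_o; exists m => r' o' Tr' os_o' jE' r'a.
  by rewrite -rm; apply: uniq_val r'a ra => //; rewrite jE.
by exists (fun j a => E (j, a)) => r o a Tr os_o; apply: (EP (_, a) r o).
Qed.

Lemma functional_complete L (M : model L) (T : set (assignment M)) x n os n' E :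
  occs_wf n os n' ->
  (forall r, T r -> exists2 rho : var -> M, respects E rho os &
     forall y, n <= y < n' -> r y = Some (rho y)) ->
  ind_sat T (functional L x os).
Proof.
move=> wf TE.
have val r o : T r -> o \in os -> exists a,
    [/\ map r (oargs o) = map Some a & r (oval o) = Some (E (oid o) a)].
  move=> /TE[rho rhoE rE] os_o; exists (map rho (oargs o)).
  have [no _ yo] := occs_wf_bounds wf os_o.
  split; last by rewrite rE ?rhoE //; rewrite /oval in yo *; lia.
  rewrite -map_comp; apply/eq_in_map => y; rewrite mem_oargs => yargs.
  by rewrite /= rE //; lia.
have eq_val r r' o o' : T r -> T r' -> o \in os -> o' \in os -> oid o = oid o' ->
    map r (oargs o) = map r' (oargs o') -> r (oval o) = r' (oval o').
  move=> Tr Tr' os_o os_o' jj'.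
  have [a [-> ->]] := val r o Tr os_o; have [b [-> ->]] := val r' o' Tr' os_o'.
  by move=> /inj_map-> => [|? ? [//]]; rewrite jj'.
split; apply/sat_ands => o os_o.
  by apply/sat_dep => s s' Ts Ts'; apply: eq_val.
apply/sat_ands => o' os_o'; rewrite /consistent; case: ifP => [/andP[/eqP jj' /eqP ll']|_].
  apply/flatP; first by rewrite flat_guard.
  move=> r Tr; apply/guard_sat; first by rewrite !size_iota.
  exact: eq_val.
by apply/flatP.
Qed.

(** * Inclusion, and the formula *)

Fixpoint eqs L (x : var) (xs ys : seq var) : ind L :=
  match xs, ys with
  | x' :: xs', y' :: ys' => And (eqv L x' y') (eqs L x xs' ys')
  | _, _ => eqv L x x
  end.

Lemma flat_eqs L x xs ys : flat (eqs L x xs ys).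
Proof. by elim: xs ys => [|? ? IH] [|? ?] //=. Qed.

Lemma eqs_sat L (M : model L) (s : assignment M) x xs ys :
  size xs = size ys -> flat_sat s (eqs L x xs ys) <-> map s xs = map s ys.
Proof.
elim: xs ys => [|y xs IH] [|z ys] //= [/IH{}IH].
by rewrite IH; split=> [[-> ->]//|[-> ->]].
Qed.

Lemma eqs_fv L x xs ys (P : set var) :
  P x -> {in xs, forall y, P y} -> {in ys, forall y, P y} ->
  ind_fv (eqs L x xs ys) `<=` P.
Proof.
move=> Px; elim: xs ys => [|y xs IH] [|z ys] //= xP yP w; try by case=> ->.
case=> [[/= ->|/= ->]|]; [by apply: xP; rewrite mem_head|by apply: yP; rewrite mem_head|].
by apply: IH => u us; [apply: xP|apply: yP]; rewrite inE us orbT.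
Qed.

(* Every value of [ws] in a row that violates [q] is a value of [vs]: the row
   with [c = d] lies in the right disjunct, hence by independence so does one
   with the same [ws] and with [c <> d]. *)
Definition inclusion L (c d : var) (q : ind L) (ws vs : seq var) : ind L :=
  Or (And (guard ws vs (neqv L c c)) (Or q (neqv L c d)))
     (And (Or (eqv L c d) (eqs L c ws vs))
          (Indep [seq Var L x | x <- ws] [::] [seq Var L x | x <- [:: c; d]])).

Lemma inclusion_fv L c d (q : ind L) ws vs (P : set var) :
  P c -> P d -> ind_fv q `<=` P -> {in ws, forall x, P x} ->
  {in vs, forall x, P x} -> ind_fv (inclusion c d q ws vs) `<=` P.
Proof.
move=> Pc Pd qP wP vP x.
case=> [[|[/qP//|[]->//]]|[[[]->//|]|]].
- by apply: guard_fv => // y [] ->.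
- exact: eqs_fv.
- rewrite [terms_fv [::]]big_nil !terms_fv_vars => -[[//|/wP//]|/=].
  by rewrite !inE => /orP[]/eqP->.
Qed.

(** The left disjunct contains neither [r], which violates [q] with equal flags, nor [t], where the
    guard would yield the absurd [c <> c]. Independence in the right one mixes the [ws] of [r] with
    the flags of [t]; as these differ, the mixed row satisfies [ws = vs]. *)
Lemma inclusion_sound L (M : model L) (T : set (assignment M)) c d (q : ind L)
    ws vs r t :
  size ws = size vs -> flat q ->
  T r -> r c = r d -> ~ flat_sat r q ->
  T t -> t c <> t d -> map t ws = map t vs ->
  ind_sat T (inclusion c d q ws vs) ->
  exists2 r', T r' & map r' vs = map r ws.
Proof.
move=> sz fq Tr rcd rq Tt tcd tv [Y [Z [TE Ysat [Zeq Zind]]]].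
have flY : flat (And (guard ws vs (neqv L c c)) (Or q (neqv L c d))).
  by rewrite /= flat_guard fq.
have flZ : flat (Or (eqv L c d) (eqs L c ws vs)) by rewrite /= flat_eqs.
have {}Ysat := (flatP Y flY).1 Ysat; have {}Zeq := (flatP Z flZ).1 Zeq.
have Zr : Z r.
  have : (Y `|` Z) r by rewrite -TE.
  by case=> // /Ysat[_ /= [//|]]; rewrite rcd.
have Zt : Z t.
  have : (Y `|` Z) t by rewrite -TE.
  by case=> // /Ysat /= []; rewrite guard_sat // => /(_ tv) [].
have [u [Zu]] := Zind r t Zr Zt erefl; rewrite !cat0s !values_vars => uw [uc ud].
exists u; first by rewrite TE; right.
have /= [|] := Zeq u Zu; first by rewrite uc ud.
by rewrite eqs_sat // => <-.
Qed.

(** The right disjunct gets the rows with [ws = vs] and those violating [q] with equal flags. The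
    row [u] needed for independence is again among them, because it satisfies [ws = vs]. *)
Lemma inclusion_complete L (M : model L) (T : set (assignment M)) c d (q : ind L)
    ws vs :
  size ws = size vs -> flat q ->
  (forall r t, T r -> T t -> (~ flat_sat r q \/ map r ws = map r vs) ->
     exists2 u, T u & [/\ map u ws = map r ws, map u vs = map r ws,
       u c = t c & u d = t d]) ->
  ind_sat T (inclusion c d q ws vs).
Proof.
move=> sz fq Tq.
pose Z : set (assignment M) := [set r | T r /\
  (map r ws = map r vs \/ (~ flat_sat r q /\ r c = r d))].
exists (T `\` Z), Z; split.
- apply/seteqP; split=> [r Tr|r [[]//|[]//]].
  by have [|] := pselect (Z r); [right|left].
- apply/flatP => [|r [Tr nZ]] /=; first by rewrite flat_guard fq.
  split; first by apply/guard_sat => // rv; case: nZ; split=> //; left.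
  have [|nq] := pselect (flat_sat r q); first by left.
  by right=> /= rcd; apply: nZ; split=> //; right.
- split; last first.
    move=> r t [Tr rZ] [Tt _] _; have [|u Tu [uw uv uc ud]] := Tq r t Tr Tt.
      by case: rZ => [|[]]; [right|left].
    exists u; split; first by split=> //; left; rewrite uw.
      by rewrite !cat0s !values_vars.
    by rewrite !cat0s !values_vars /= uc ud.
  apply/flatP => [|r [Tr [rv|[_ rcd]]]] /=; first by rewrite flat_eqs.
    by right; apply/eqs_sat.
  by left.
Qed.

(* The variables [N], [N + 1], [N + 2] are the default variable of [theta] and
   the two flags of [inclusion]. *)
Definition rel_occ (N k : nat) : occ := (0, N + 3, k.+1).

(** The arguments of [o], to be quantified universally, are [b] and [ws]. The guard says that the
    relation coded by the function of A contains that of the team; [inclusion], which concerns the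
    rows where the value is [b], gives the converse. *)
Definition team_body L (vs : seq var) (N : nat) (os : seq occ) (theta : ind L) :
    ind L :=
  let o := rel_occ N (size vs) in
  let b := ost o in
  let ws := behead (oargs o) in
  And (And (functional L N (o :: os)) theta)
      (And (guard ws vs (eqv L (oval o) b))
           (inclusion N.+1 N.+2 (neqv L (oval o) b) ws vs)).

(** Hence all arguments stay universal when the value variables are quantified existentially. *)
Lemma oargs_notin n os n' o x :
  occs_wf n os n' -> o \in os -> x \in oargs o -> x \notin map oval os.
Proof.
move=> wf os_o; rewrite mem_oargs => xo; apply/mapP => -[o' os_o' xE].
by case: (occs_disjoint wf os_o os_o') => [oo'|lt|lt];
  move: xo xE lt || move: xo xE; rewrite -?oo' /oval; lia.
Qed.

Lemma rel_occ_wf N k os n' :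
  occs_wf (oval (rel_occ N k)).+1 os n' -> occs_wf (N + 3) (rel_occ N k :: os) n'.
Proof.
move=> wf; have := occs_wf_le wf.
by rewrite /= wf /oid /ost /oval /= andbT => ?; apply/andP; split; lia.
Qed.

Lemma team_body_fv L vs N os (theta : ind L) n' :
  occs_wf (oval (rel_occ N (size vs))).+1 os n' ->
  (forall x, ind_fv theta x -> N <= x < n') ->
  ind_fv (team_body vs N os theta) `<=` [set x | x \in vs \/ N <= x < n'].
Proof.
move=> /[dup] /rel_occ_wf wf /occs_wf_le le thN.
rewrite /oval /ost /oar /= in le.
set P := [set x | _]; pose o := rel_occ N (size vs).
have rP x : N <= x < n' -> P x by right.
have bP : P (ost o) by apply: rP; rewrite /ost /=; lia.
have vP : P (oval o) by apply: rP; rewrite /oval /ost /oar /=; lia.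
have wsP : {in behead (oargs o), forall x, P x}.
  by move=> x; rewrite /= mem_iota /ost /= => xw; apply: rP; lia.
have vsP : {in vs, forall x, P x} by left.
have bvP (f : var -> var -> ind L) :
  (ind_fv (f (oval o) (ost o)) = [set oval o] `|` [set ost o]) ->
  ind_fv (f (oval o) (ost o)) `<=` P by move=> -> y [] ->.
move=> x [[|/thN]|[|]]; [|exact: rP| |].
- by apply: (functional_fv wf) => [|y yN]; apply: rP; lia.
- exact: (guard_fv wsP vsP (bvP (@eqv L) erefl)).
- apply: (inclusion_fv _ _ (bvP (@neqv L) erefl) wsP vsP); apply: rP; lia.
Qed.

(** The hypotheses on [T] are what the quantifier prefix provides: on [vs] its rows come from [X],
    and each row of [X] occurs with all values of the universal variables. The functions are then
    extracted by [functional_sound]. *)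
Lemma team_sound L (M : model L) (X T : set (assignment M)) vs N os
    (theta : ind L) n' (s0 : assignment M) :
  let o := rel_occ N (size vs) in
  occs_wf (oval o).+1 os n' -> flat theta ->
  (forall x, ind_fv theta x -> N <= x < n') ->
  X s0 -> (exists l, map s0 vs = map Some l) ->
  (forall r, T r -> exists2 s, X s & {in vs, r =1 s}) ->
  (forall r x, T r -> N <= x < n' -> exists m, r x = Some m) ->
  (forall s (rho : var -> M), X s -> exists2 r, T r & {in vs, r =1 s} /\
     forall x, N <= x < n' -> x \notin map oval (o :: os) -> r x = Some (rho x)) ->
  ind_sat T (team_body vs N os theta) ->
  exists E : nat -> seq M -> M,
    (forall l, size l = size vs ->
       (exists2 s, X s & map s vs = map Some l) <-> forall b, E 0 (b :: l) = b) /\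
    forall rho, respects E rho (o :: os) -> flat_sat (tot rho) theta.
Proof.
move=> o wf' fth thN Xs0 [l0 s0E] TX Tdef XT [[Tfun Tth] [Tguard Tincl]].
have wf := rel_occ_wf wf'.
have le := occs_wf_le wf'; rewrite /oval /ost /oar /= in le.
have valb o' : o' \in o :: os -> N <= oval o' < n'.
  by move=> /(occs_wf_bounds wf)[]; rewrite /oval; lia.
have argsb o' x : o' \in o :: os -> x \in oargs o' -> N <= x < n'.
  by move=> /(occs_wf_bounds wf)[]; rewrite mem_oargs; lia.
have rowE r (rho : var -> M) o' : o' \in o :: os ->
    (forall x, N <= x < n' -> x \notin map oval (o :: os) -> r x = Some (rho x)) ->
    map r (oargs o') = map Some (map rho (oargs o')).
  move=> os_o' rE; rewrite -map_comp; apply/eq_in_map => x xo'.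
  by apply: rE; [exact: argsb xo'|exact: (oargs_notin wf) xo'].
have [||E EP] := functional_sound wf _ _ Tfun.
- by move=> r o' Tr /valb; apply: Tdef.
- move=> rho; have [r Tr [_ rE]] := XT s0 rho Xs0; exists r => // o' os_o'.
  exact: rowE.
have oin : o \in o :: os by rewrite mem_head.
have wsE (r : assignment M) b l : map r (oargs o) = map Some (b :: l) ->
    r (ost o) = Some b /\ map r (behead (oargs o)) = map Some l by case=> -> ->.
(* The flags and the arguments of [o] are universal, hence can be prescribed over any row of [X]. *)
have row s (c d b : M) l : X s -> size l = size vs -> exists2 r, T r &
    [/\ {in vs, r =1 s}, r N.+1 = Some c, r N.+2 = Some d,
      map r (oargs o) = map Some (b :: l) & r (oval o) = Some (E 0 (b :: l))].
  move=> Xs sl.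
  pose rho0 x := if x == N.+1 then c else d.
  have [|rho [rr0 rhoE _]] := @occ_ex _ E rho0 o (b :: l); first by rewrite /= sl.
  have [r Tr [rs rE]] := XT s rho Xs; exists r => //.
  have raE : map r (oargs o) = map Some (b :: l) by rewrite (rowE _ rho) // rhoE.
  have low x : N <= x < N + 3 -> r x = Some (rho0 x).
    move=> xN; rewrite rE ?rr0 //; [|by lia|].
      by rewrite /ost /=; lia.
    apply/mapP => -[o' os_o' xE]; have [no _ _] := occs_wf_bounds wf os_o'.
    by move: xN; rewrite xE /oval; lia.
  split=> //; last exact: EP raE.
  - by rewrite low /rho0 ?eqxx //; lia.
  - by rewrite low /rho0 ?ifF //; [apply/negbTE|]; lia.
exists E; split=> [l sl|rho rhoE].
  split=> [[s Xs sE] b|Eb].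
    have [m _] := two_elements M.
    have [r Tr [rs _ _ /wsE[rb rw] rv]] := row s m m b l Xs sl.
    have /flatP/(_ r Tr) := Tguard; rewrite flat_guard => /(_ erefl).
    move/guard_sat; rewrite size_iota => /(_ erefl); rewrite rw /=.
    rewrite (_ : map r vs = map s vs); last exact/eq_in_map.
    by rewrite sE => /(_ erefl); rewrite rb [oval _ in LHS]/= rv => -[].
  (* [r] has equal flags and violates [q] at [l]; [t] has different flags, and its [ws] is the tuple
     of [s0], so that [ws = vs]. *)
  have [c [d cd]] := two_elements M.
  have [r Tr [_ rc rd /wsE[rb rw] rv]] := row s0 c c c l Xs0 sl.
  have sl0 : size l0 = size vs by have := congr1 size s0E; rewrite !size_map.
  have [t Tt [ts tc td /wsE[tb tw] tv]] := row s0 c d c l0 Xs0 sl0.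
  have [||||||r' Tr' r'E] := @inclusion_sound L M T N.+1 N.+2
    (neqv L (oval o) (ost o)) (behead (oargs o)) vs r t _ _ Tr _ _ Tt _ _ Tincl.
  - by rewrite size_iota.
  - by [].
  - by rewrite rc rd.
  - by apply=> /=; rewrite rv rb Eb.
  - by rewrite tc td => -[].
  - rewrite tw -s0E; apply/esym/eq_in_map; exact: ts.
  have [s Xs r's] := TX r' Tr'; exists s => //.
  by rewrite -rw -r'E; apply/esym/eq_in_map.
have [r Tr [_ rE]] := XT s0 rho Xs0.
have := (flatP T fth).1 Tth r Tr.
(* [r] copies [rho] on the universal variables, and on the value variables both follow [E]. *)
rewrite (@flat_sat_eq _ _ r (tot rho)) // => x /thN xN.
have [/mapP[o' os_o' ->]|/rE->//] := boolP (x \in map oval (o :: os)).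
rewrite (EP r o' (map rho (oargs o'))) //; last exact: rowE.
by rewrite /tot rhoE.
Qed.

(** Here every row computes its value variables by the given [E]. The independence atom holds since
    rows of [X] and universal values combine freely. *)
Lemma team_complete L (M : model L) (X T : set (assignment M)) vs N os
    (theta : ind L) n' (E : nat -> seq M -> M) :
  let o := rel_occ N (size vs) in
  occs_wf (oval o).+1 os n' -> flat theta ->
  (forall x, ind_fv theta x -> N <= x < n') ->
  (forall s, X s -> exists l, map s vs = map Some l) ->
  (forall r, T r -> exists2 s, X s & {in vs, r =1 s}) ->
  (forall r, T r -> exists2 rho : var -> M, respects E rho (o :: os) &
     forall y, N <= y < n' -> r y = Some (rho y)) ->
  (forall s (rho : var -> M), X s -> exists2 r, T r & {in vs, r =1 s} /\
     forall x, N <= x < n' -> x \notin map oval (o :: os) -> r x = Some (rho x)) ->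
  (forall b l, size l = size vs ->
     E 0 (b :: l) = b <-> exists2 s, X s & map s vs = map Some l) ->
  (forall rho, respects E rho (o :: os) -> flat_sat (tot rho) theta) ->
  ind_sat T (team_body vs N os theta).
Proof.
move=> o wf' fth thN Xdef TX TE XT EA Eth.
have wf := rel_occ_wf wf'.
have le := occs_wf_le wf'; rewrite /oval /ost /oar /= in le.
have oin : o \in o :: os by rewrite mem_head.
have val r : T r -> exists b l, [/\ size l = size vs, r (ost o) = Some b,
    map r (behead (oargs o)) = map Some l & r (oval o) = Some (E 0 (b :: l))].
  move=> /TE[rho rhoE rE].
  exists (rho (ost o)), (map rho (behead (oargs o))).
  have argsE x : x \in oargs o -> r x = Some (rho x).
    rewrite mem_oargs /oval /ost /= => xo; apply: rE; rewrite /oar /= in xo; lia.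
  split; first by rewrite size_map size_iota.
  - by apply: argsE; rewrite mem_head.
  - rewrite -map_comp; apply/eq_in_map => x xw; apply: argsE.
    by rewrite inE xw orbT.
  - by rewrite rE ?rhoE // /oval /ost /oar /=; lia.
split; split.
- apply: (functional_complete (E := E) _ wf) => r /TE[rho rhoE rE].
  by exists rho => // y yN; apply: rE; lia.
- apply/flatP => // r /TE[rho rhoE rE].
  rewrite (@flat_sat_eq _ _ r (tot rho)); first exact: Eth.
  by move=> x /thN/rE.
- apply/flatP; first by rewrite flat_guard.
  move=> r Tr; apply/guard_sat; first by rewrite size_iota.
  have [b [l [sl rb -> rv]]] := val r Tr; have [s Xs rs] := TX r Tr.
  rewrite (_ : map r vs = map s vs); last exact/eq_in_map.
  by move=> sE /=; rewrite rv rb; congr Some; apply/EA => //; exists s.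
- apply: inclusion_complete => //; first by rewrite size_iota.
  move=> r t Tr Tt rq.
  have [b [l [sl rb rw rv]]] := val r Tr.
  (* In both cases [l] belongs to the relation of the team: either the value is [b], or [ws = vs]
     and [vs] comes from [X]. *)
  have [s Xs sE] : exists2 s, X s & map s vs = map Some l.
    case: rq => [/contrapT/=|rwv].
      by rewrite rv rb => -[/EA]; apply.
    have [s Xs rs] := TX r Tr; exists s => //.
    by rewrite -rw rwv; apply/esym/eq_in_map.
  (* The flags of [t] are combined with the arguments [b :: l] over the row [s], whose [vs] is [l].
     The default [b] is not reached at the flags, where [t] is defined. *)
  pose rho0 x := odflt b (t x).
  have [|rho [rr0 rhoE _]] := @occ_ex _ E rho0 o (b :: l); first by rewrite /= sl.
  have [u Tu [us uE]] := XT s rho Xs.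
  have low x : N <= x < N + 3 -> u x = t x.
    move=> xN; rewrite uE ?rr0 //; first 1 last.
    - by rewrite /ost /=; lia.
    - by lia.
    - apply/mapP => -[o' os_o' xE]; have [no _ _] := occs_wf_bounds wf os_o'.
      by move: xN; rewrite xE /oval; lia.
    have [rho1 _ tE] := TE t Tt.
    by rewrite /rho0 tE //; lia.
  exists u => //; split; [| |by apply: low; lia|by apply: low; lia].
    have -> : map u (behead (oargs o)) = behead (map u (oargs o)) by [].
    rewrite rw (_ : map u (oargs o) = map Some (b :: l)) //.
    rewrite -rhoE -map_comp; apply/eq_in_map => x xo.
    apply: uE; last exact: (oargs_notin wf) xo.
    by move: xo; rewrite mem_oargs /oval /ost /oar /=; lia.
  by rewrite rw -sE; apply/eq_in_map.
Qed.

(** * The relation of a team, and the assembly of the formula *)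

Lemma map_args_tuple T k (v : k.-tuple var) (s : var -> T) :
  map s v = args (s \o tnth v).
Proof. by rewrite -map_args /args map_tnth_enum. Qed.

Lemma team_relP D k (v : k.-tuple var) (X : set (assignment D)) (a : 'I_k -> D) :
  team_rel v X a <-> exists2 s, X s & map s v = map Some (args a).
Proof.
split=> -[s Xs sE]; exists s => //.
  by rewrite map_args_tuple map_args; congr args; apply/funext.
move=> i; move: sE; rewrite map_args_tuple map_args => /(congr1 (nth None ^~ i)).
by rewrite !nth_args.
Qed.

Lemma alls_fv L us (phi : ind L) :
  ind_fv (foldr (@All L) phi us) = ind_fv phi `\` [set` us].
Proof.
elim: us => [|x us IH] /=; first by apply/seteqP; split=> [y|y []].
rewrite IH; apply/seteqP; split=> y /=; rewrite inE.
  by move=> [[py yus] yx]; split=> // /orP[/eqP|].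
by move=> [py /negP]; rewrite negb_or => /andP[/eqP yx /negP].
Qed.

Lemma exs_fv L us (phi : ind L) :
  ind_fv (foldr (@Ex L) phi us) = ind_fv phi `\` [set` us].
Proof.
elim: us => [|x us IH] /=; first by apply/seteqP; split=> [y|y []].
rewrite IH; apply/seteqP; split=> y /=; rewrite inE.
  by move=> [[py yus] yx]; split=> // /orP[/eqP|].
by move=> [py /negP]; rewrite negb_or => /andP[/eqP yx /negP].
Qed.

Theorem corollary6p3 (L : signature) (k : nat) (Phi : eso (add_rel L k))
    (v : k.-tuple var) :
  eso_fv Phi = set0 -> uniq v ->
  exists phi : ind L,
    ind_fv phi `<=` [set` v] /\
    forall (M : model L) (V : set var) (X : set (assignment M)),
      team_domain X V -> [set` v] `<=` V -> X !=set0 ->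
      (ind_sat X phi <-> eso_true (expand_rel (team_rel v X)) Phi).
Proof.
move=> cl _; pose p := sf_of_eso Phi (interp_id L k) 1.
(* [N] lies beyond the variables of [v], and it bounds the function indices because Skolem functions
   share their numbering with the fresh variables. *)
pose N := maxn (sf_ids p) (\max_(x <- v) x).+1.
pose o := rel_occ N (size v); pose n := (oval o).+1.
have oE : n = (N + 3 + (size v).+1).+1 by [].
have idp : sf_ids p <= n by rewrite oE /N; lia.
have vN x : x \in tval v -> x < N.
  by move=> xv; rewrite /N leq_max ltnS (leq_bigmax_seq x) ?orbT.
have Nn : N <= N < n by rewrite oE; lia.
have := @skolem_wf L N N true [::] n p idp Nn (fun _ => ltac:(by [])).
have sound (M : model L) E (rho : var -> M) :=
  @skolem_sound L M N true [::] n p E rho idp.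
have complete (M : model L) E := @skolem_complete L M N true [::] n p E idp.
case: skolem sound complete => -[n' os] theta sound complete [wf' fth thN].
have wf := rel_occ_wf wf'.
(* The value variables become existential; all others from [N] to below [n'], among them the default
   variable and the two flags, become universal. *)
pose ys := map oval (o :: os).
pose us := [seq x <- iota N (n' - N) | x \notin ys].
have ysN x : x \in ys -> N <= x < n'.
  by move=> /mapP[o' /(occs_wf_bounds wf)[no _ yo] ->]; rewrite /oval in yo *; lia.
have usE x : (x \in us) = (x \notin ys) && (N <= x < n').
  by rewrite mem_filter mem_iota; congr (_ && _); have := occs_wf_le wf; lia.
have vus x : x \in tval v -> x \notin us.
  by move=> /vN xN; rewrite usE; apply/negP => /andP[_]; lia.
have vys x : x \in tval v -> x \notin ys.
  by move=> /vN xN; apply/negP => /ysN; lia.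
exists (foldr (@All L) (foldr (@Ex L) (team_body v N os theta) ys) us); split.
  rewrite alls_fv exs_fv => x [[/(team_body_fv wf' thN)[//|xN] /negP xys]].
  by case; rewrite /= usE xys.
move=> M V X XV vV [s0 Xs0]; rewrite sat_alls sat_exs.
have Xdef s : X s -> exists l, map s v = map Some l.
  move=> Xs; have [m _] := two_elements M.
  exists (map (fun x => odflt m (s x)) v); rewrite -map_comp.
  apply/eq_in_map => x xv /=; have : asg_dom s x by rewrite (XV s Xs); apply: vV.
  by rewrite /asg_dom /=; case: (s x).
split=> [[Y [Ysat YX XY]]|].
  have [|||||E [EA Eth]] := @team_sound L M X Y v N os theta n' s0 wf' fth thN Xs0.
  - exact: Xdef.
  - move=> r /YX[s' [s Xs [ss' _]] [rs' _]]; exists s => // x xv.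
    by rewrite rs' ?ss' ?vus ?vys.
  - move=> r x /YX[s' [s Xs [_ ss']] [rs' rd]] xN.
    have [/rd//|xys] := boolP (x \in ys).
    by rewrite rs' //; apply: ss'; rewrite usE xys.
  - move=> s rho Xs; pose s' x := if x \in us then Some (rho x) else s x.
    have [|r Yr [rs' _]] := XY s'.
      exists s => //; split=> x; rewrite /s'; first by move=> /negbTE->.
      by move=> ->; exists (rho x).
    exists r => //; split=> [x xv|x xN xys].
      by rewrite rs' ?vys // /s' (negbTE (vus x xv)).
    by rewrite rs' // /s' usE xys xN.
  - exact: Ysat.
  have AE a : team_rel v X a <-> forall b, E 0 (b :: args a) = b.
    by rewrite team_relP EA // size_args size_tuple.
  have [m _] := two_elements M.
  (* The starting [rho] has to respect only [o]: the counterexample from [sound] changes no variable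
     below [n], so [o] stays respected. *)
  have wfo : occs_wf (N + 3) [:: o] n by rewrite /= leqnn /oid oE /=; lia.
  have [rho [rhoE _]] := respects_ex E (fun=> m) wfo.
  apply: (sf_of_eso_sound (m0 := rho N) (interp_id_ok AE) cl).
  apply: contrapT => /(sound M E rho)[|//|rho' [rr' rE]]; first by lia.
  apply; apply: Eth; apply/respects_cons; split=> //.
  have : respects E rho' [:: o].
    by apply: respects_eq rhoE => //; [exact: wfo|move=> x xn; rewrite rr' //; lia].
  by move/respects_cons => [].
have [g gA] := @rel_as_fun L M k (team_rel v X).
(* Only index [0] matters at this point, so a constant sequence suffices. *)
pose Eg (j : nat) := g.
have AE a : team_rel v X a <-> forall b, Eg 0 (b :: args a) = b.
  split=> [Aa b|gb]; first exact/gA.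
  by have [m _] := two_elements M; apply/(gA m).
move=> /(sf_of_eso_complete (interp_id_ok AE) cl)[E1 [E1g E1p]].
have [||E [E1E Eth]] := complete M E1; [lia|by []|].
have E0 : E 0 = g by rewrite E1E ?E1g //; lia.
(* The witnessing team: universal variables are unrestricted, and value variables are computed by
   [E]. *)
exists [set r | (exists2 s', (exists2 s, X s & extends s s' us) & extends s' r ys) /\
  exists2 rho : var -> M, respects E rho (o :: os) &
     forall y, N <= y < n' -> r y = Some (rho y)].
have ext s' : (exists2 s, X s & extends s s' us) -> exists rho0 : var -> M,
    forall x, x \in us -> s' x = Some (rho0 x).
  move=> [s Xs [_ ss']]; have [m _] := two_elements M.
  exists (fun x => odflt m (s' x)) => x /ss'[m' ->//].
(* Given the universal values, [respects_ex] supplies the value variables. *)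
have lift s' (rho0 : var -> M) : (forall x, x \in us -> s' x = Some (rho0 x)) ->
    exists r, extends s' r ys /\ exists2 rho : var -> M,
      respects E rho (o :: os) & forall y, N <= y < n' -> r y = Some (rho y).
  move=> s'E; have [rho [rhoE rr0]] := respects_ex E rho0 wf.
  exists (fun x => if x \in ys then Some (rho x) else s' x); split.
    split=> x; first by move=> /negbTE->.
    by move=> ->; exists (rho x).
  exists rho => // y yN; case: ifP => // /negbT yys.
  by rewrite s'E ?rr0 // usE yys.
split=> [|r []//|s' Xs'].
  apply: (team_complete (X := X) (E := E) wf' fth thN Xdef).
  - move=> r [[s' [s Xs [ss' _]] [rs' _]] _]; exists s => // x xv.
    by rewrite rs' ?ss' ?vus ?vys.
  - by move=> r [].
  - move=> s rho Xs; pose s' x := if x \in us then Some (rho x) else s x.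
    have s'E x : x \in us -> s' x = Some (rho x) by rewrite /s' => ->.
    have [r [[rs' rd] rE]] := lift s' rho s'E.
    exists r.
      split=> //; exists s' => //; exists s => //.
      split=> x; rewrite /s'; first by move=> /negbTE->.
      by move=> ->; exists (rho x).
    split=> [x xv|x xN xys].
      by rewrite rs' ?vys // /s' (negbTE (vus x xv)).
    by rewrite rs' // s'E // usE xys.
  - move=> b l sl; rewrite E0.
    have lE : args (fun i : 'I_k => nth b l i) = l.
      by apply: args_nth; rewrite sl size_tuple.
    by rewrite -lE gA team_relP.
  - move=> rho /respects_cons[_ rE]; apply: Eth => //; exact: E1p.
have [rho0 rho0E] := ext s' Xs'; have [r [sr rE]] := lift s' rho0 rho0E.
by exists r => //; split=> //; exists s'.
Qed.
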